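(* Let $k>0$, $I>0$, $0<A_1\le A_2\le A_3$, $J=\mathrm{diag}(A_1,A_2,A_3)$, and consider the system of ODEs for $(\Omega,\Omega_1)\in\mathbb{R}^3\times\mathbb{R}^3$ $$\dot\Omega=J^{-1}\big(k(\Omega_1-\Omega)-\Omega\times(J\Omega)\big),\qquad \dot\Omega_1=-\frac{k}{I}(\Omega_1-\Omega)-\Omega\times\Omega_1 .$$ Let $(\Omega^*,\Omega_1^* )$ be an equilibrium point of this system such that $\Omega^*=\Omega_1^*$ is an eigenvector of $J$ corresponding to the eigenvalue $\lambda^*\in\{A_1,A_2,A_3\}$. (i) If $\lambda^*=A_3$, then $(\Omega^*,\Omega_1^* )$ is exponentially stable for the (nonlinear) system, in the sense defined in the context. (ii) If $\lambda^*\in\{A_1,A_2\}$ with $A_1\le A_2<A_3$, then $(\Omega^*,\Omega_1^* )$ is unstable.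
   Context: Here $\times$ is the cross product in $\mathbb{R}^3$ and $\|\cdot\|$ the Euclidean norm. Eigenvectors are nonzero. Let $\mathcal{E}\subset\mathbb{R}^6$ be the set of equilibrium points of the system (zeros of its right-hand side). An equilibrium $z^*$ is stable (in the sense of Lyapunov) if for every $\varepsilon>0$ there is $\delta>0$ such that for any $z_0$ with $\|z_0-z^*\|\le\delta$ the unique solution $z$ with $z(t_0)=z_0$ (where $t_0\ge 0$ is the initial time) satisfies $\|z(t)-z^*\|<\varepsilon$ for all $t\ge t_0$. It is unstable if it is not stable. Exponentially stable means: $z^*$ is stable in the sense of Lyapunov, and there exists $\delta>0$ such that for every $z_0$ with $\|z_0-z^*\|<\delta$ the unique solution $z$ with $z(0)=z_0$ exists for all $t\ge0$ and there exist $z_\infty\in\mathcal{E}$ and constants $c_1,c_2>0$ such that $\|z(t)-z_\infty\|\le c_1e^{-c_2t}$ for all $t\ge0$ (note that $z_\infty$ need not equal $z^*$). *)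

(* Defs.v *)
(* MathComp-Analysis; the real numbers are an arbitrary R : realType. *)
From HB Require Import structures.
From mathcomp Require Import all_boot all_order all_algebra.
From mathcomp Require Import all_classical all_reals all_analysis.
Set Implicit Arguments.
Unset Strict Implicit.
Unset Printing Implicit Defensive.
Import Order.TTheory GRing.Theory Num.Theory.
Import numFieldNormedType.Exports.
Local Open Scope classical_set_scope.
Local Open Scope ring_scope.

Definition crossmul (R : realType) (u v : 'cV[R]_3) : 'cV[R]_3 :=
  \col_(i < 3) [:: u 1 0 * v 2 0 - u 2 0 * v 1 0;
                   u 2 0 * v 0 0 - u 0 0 * v 2 0;
                   u 0 0 * v 1 0 - u 1 0 * v 0 0]`_i.

(* R^6 is the product 'cV_3 * 'cV_3; a state is the pair (Omega, Omega_1). *)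
Notation state R := ('cV[R]_3 * 'cV[R]_3)%type.

(* The library norm `|z| on this type is the sup norm. *)
Definition enorm (R : realType) (z : state R) : R :=
  Num.sqrt (\sum_(i < 3) z.1 i 0 ^+ 2 + \sum_(i < 3) z.2 i 0 ^+ 2).

Definition inertia (R : realType) (A1 A2 A3 : R) : 'M[R]_3 :=
  diag_mx (\row_(i < 3) [:: A1; A2; A3]`_i).

Definition rhs (R : realType) (k I : R) (J : 'M[R]_3) (z : state R) : state R :=
  let Om := z.1 in let Om1 := z.2 in
  (invmx J *m (k *: (Om1 - Om) - crossmul Om (J *m Om)),
   - ((k / I) *: (Om1 - Om)) - crossmul Om Om1).

Definition eigenvector (R : realType) (n : nat) (M : 'M[R]_n) (a : R)
    (v : 'cV[R]_n) : Prop :=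
  v != 0 /\ M *m v = a *: v.

Section Autonomous.
Context (R : realType) (f : state R -> state R).

Definition equilibria : set (state R) := [set z | f z = 0].

(* z' = f z on [t0, +oo[ with z t0 = z0. The difference quotients are restricted
   to times s >= t0, so the derivative at t0 is one-sided and the values of the
   total function z before t0 are irrelevant. *)
Definition is_solution (t0 : R) (z0 : state R) (z : R -> state R) : Prop :=
  z t0 = z0 /\
  forall t, t0 <= t ->
    (fun s => (s - t)^-1 *: (z s - z t)) @ within [set s | t0 <= s] t^' --> f (z t).

Definition is_unique_solution (t0 : R) (z0 : state R) (z : R -> state R) : Prop :=
  is_solution t0 z0 z /\
  forall y, is_solution t0 z0 y -> forall t, t0 <= t -> y t = z t.

Definition lyapunov_stable (t0 : R) (zs : state R) : Prop :=
  forall eps : R, 0 < eps -> exists2 delta : R, 0 < delta &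
    forall z0, enorm (z0 - zs) <= delta ->
      exists2 z, is_unique_solution t0 z0 z &
        forall t, t0 <= t -> enorm (z t - zs) < eps.

Definition unstable (t0 : R) (zs : state R) : Prop := ~ lyapunov_stable t0 zs.

(* The limit zoo depends on z0 and need not be zs. *)
Definition exponentially_stable (t0 : R) (zs : state R) : Prop :=
  lyapunov_stable t0 zs /\
  exists2 delta : R, 0 < delta &
    forall z0, enorm (z0 - zs) < delta ->
      exists2 z, is_unique_solution 0 z0 z &
        exists zoo c1 c2, [/\ equilibria zoo, 0 < c1, 0 < c2 &
          forall t, 0 <= t -> enorm (z t - zoo) <= c1 * expR (- c2 * t)].

End Autonomous.

(* Main.v *)
Require Import Defs.
From mathcomp Require Import all_boot all_order all_algebra.
From mathcomp Require Import all_classical all_reals all_analysis.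
From mathcomp Require Import ring lra.
Import Order.TTheory GRing.Theory Num.Theory.
Import numFieldNormedType.Exports.
Set Implicit Arguments.
Unset Strict Implicit.
Unset Printing Implicit Defensive.
Local Open Scope classical_set_scope.
Local Open Scope ring_scope.

(** Write x = Omega, y = Omega_1, d = y - x (the slip) and n = x cross J x (the
    gyroscopic torque).  Twice the energy, 2E = x . J x + I |y|^2, decreases at
    the rate 2k |d|^2, while the squared angular momentum |J x + I y|^2 is
    conserved.  For an eigenvalue lam of J the function

      excess lam = (lam + I) 2E - |J x + I y|^2

    vanishes at the equilibria (w, w) with J w = lam w, and it decreases at the
    rate 2k (lam + I) |d|^2 along solutions.  This rate is blind to n, hence
    to the distance between x and the eigenspace.  The cross term
    mixed = - d . n repairs this: differentiating d produces - n . J^-1 n, and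
    all remaining terms carry a factor d.  So lyap = excess + eps mixed, with
    eps small, decreases at a rate at least kap (|d|^2 + |n|^2) on bounded sets
    (lyap_dissipation).  Moreover the residual |d|^2 + |n|^2 dominates |excess|
    near (w, w) (excess_le_near), because |n|^2 controls the part of x that
    leaves the eigenspace as long as x stays close to w, which is nonzero.

    (i) For lam = A3 the excess is a nonnegative quadratic form that dominates
    the residual.  Then lyap is comparable with the residual and decays
    exponentially, and so does the speed, whose square is bounded by a multiple
    of the residual.  The length of the trajectory is therefore at most a
    multiple of the initial distance to (w, w): the trajectory never leaves the
    neighbourhood where the estimates hold (local_attraction), and it converges
    exponentially to a zero of the vector field.  A fixed Lyapunov function
    thus handles all multiplicities of A3, although the equilibrium is not
    isolated and the limit depends on the initial state.

    (ii) For lam < A3 a displacement of (w, w) along the third axis makes the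
    excess negative, and it stays below this negative value.  A trajectory that
    remained near (w, w) would keep the residual bounded away from 0, so lyap
    would tend to minus infinity, although it is bounded near (w, w).

    Stability also asserts existence and uniqueness of solutions on the whole
    half-line.  The vector field with clamped coordinates is bounded and
    globally Lipschitz, so Picard iteration applies (picard_exists,
    picard_unique); the trapping argument of (i) shows that its solutions, and
    those of the original field, stay where clamping has no effect. *)

(** * Calculus of one real variable *)

(** Rules for sums and products in the ring of functions do not unify with
    lambda-terms; the pointwise forms below do. *)
Section Calculus.
Context {R : realType}.
Implicit Types (f g : R -> R) (t : R).

Lemma is_derive_add f g t a b : is_derive t 1 f a -> is_derive t 1 g b ->
  is_derive t 1 (fun s => f s + g s) (a + b).
Proof. by move=> hf hg; exact: is_deriveD. Qed.

Lemma is_derive_opp f t a : is_derive t 1 f a ->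
  is_derive t 1 (fun s => - f s) (- a).
Proof. by move=> hf; exact: is_deriveN. Qed.

Lemma is_derive_sub f g t a b : is_derive t 1 f a -> is_derive t 1 g b ->
  is_derive t 1 (fun s => f s - g s) (a - b).
Proof. by move=> hf hg; exact: is_deriveB. Qed.

Lemma is_derive_mul f g t a b : is_derive t 1 f a -> is_derive t 1 g b ->
  is_derive t 1 (fun s => f s * g s) (f t * b + g t * a).
Proof. by move=> hf hg; exact: is_deriveM. Qed.

Lemma is_derive_const (c t : R) : is_derive t 1 (fun=> c) (0 : R).
Proof. exact: is_derive_cst. Qed.

Lemma is_derive_scale (c : R) f t a : is_derive t 1 f a ->
  is_derive t 1 (fun s => c * f s) (c * a).
Proof.
move=> hf; apply: (is_derive_eq (is_derive_mul (is_derive_const c t) hf)).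
by rewrite mulr0 addr0.
Qed.

Lemma is_derive_sqr f t a : is_derive t 1 f a ->
  is_derive t 1 (fun s => f s ^+ 2) (2 * f t * a).
Proof.
move=> hf; apply: (is_derive_eq (is_derive_mul hf hf)).
by ring.
Qed.

Lemma is_derive_expR_affine (c t0 t : R) :
  is_derive t 1 (fun s => expR (c * (s - t0))) (c * expR (c * (t - t0))).
Proof.
have h : is_derive t 1 (fun s => c * (s - t0)) c.
  apply: (is_derive_eq (is_derive_scale c
    (is_derive_sub (is_derive_id t 1) (is_derive_const t0 t)))).
  by rewrite subr0 mulr1.
by apply: (is_derive_eq (is_derive1_comp (is_derive_expR _) h)); rewrite mulrC.
Qed.

Lemma is_derive_congr f g t a : f =1 g -> is_derive t 1 f a -> is_derive t 1 g a.
Proof. by move=> /funext ->. Qed.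

Lemma is_derive_continuous f t a : is_derive t 1 f a -> {for t, continuous f}.
Proof.
by move=> [hf _]; apply: differentiable_continuous; apply/derivable1_diffP.
Qed.

Lemma derive_le0_nonincreasing f (a b : R) : a <= b ->
  (forall t, a <= t <= b -> exists2 d, is_derive t 1 f d & d <= 0) -> f b <= f a.
Proof.
move=> ab hf; have df t : a <= t <= b -> is_derive t 1 f ('D_1 f t).
  by move=> /hf[d [fd _] _]; exact/derivableP.
have [||c cab e] := @MVT_segment R f (fun t => 'D_1 f t) a b ab.
- by move=> x; rewrite in_itv/= => /andP[ax xb]; apply: df; rewrite !ltW.
- apply: derivable_within_continuous => x; rewrite in_itv/= => xab.
  by have [] := df _ xab.
rewrite -subr_le0 e mulr_le0_ge0 ?subr_ge0 //.
by move: cab; rewrite in_itv/= => /hf[d [_ ->]].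
Qed.

(** Mean value inequality with a varying bound.  A dominating function such as a
    multiple of an exponential then replaces the estimation of an integral. *)
Lemma increment_le_dominated f df g dg (a b : R) : a <= b ->
  (forall t, a <= t <= b -> is_derive t 1 f (df t)) ->
  (forall t, a <= t <= b -> is_derive t 1 g (dg t)) ->
  (forall t, a <= t <= b -> `|df t| <= dg t) -> `|f b - f a| <= g b - g a.
Proof.
move=> ab hf hg h.
have h1 : f b - g b <= f a - g a.
  apply: (@derive_le0_nonincreasing (fun s => f s - g s) a b) => // t tab.
  exists (df t - dg t); first by apply: is_derive_sub; [exact: hf|exact: hg].
  by have := h t tab; rewrite ler_norml => /andP[]; lra.
have h2 : - f b - g b <= - f a - g a.
  apply: (@derive_le0_nonincreasing (fun s => - f s - g s) a b) => // t tab.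
  exists (- df t - dg t).
    by apply: is_derive_sub; [apply: is_derive_opp; exact: hf|exact: hg].
  by have := h t tab; rewrite ler_norml => /andP[]; lra.
by rewrite ler_norml; apply/andP; split; lra.
Qed.

(** Integration starts one unit before t0 so that the fundamental theorem, which
    needs an interior point, gives a two-sided derivative at t0 as well. *)
Definition primitive (t0 : R) (u : R -> R) (t : R) : R :=
  Rintegral lebesgue_measure `[t0 - 1, t] u
  - Rintegral lebesgue_measure `[t0 - 1, t0] u.

Lemma is_derive_primitive t0 (u : R -> R) t : continuous u -> t0 <= t ->
  is_derive t 1 (primitive t0 u) (u t).
Proof.
move=> cu t0t.
have tt1 : t < t + 1 by rewrite ltrDl.
have lt : t0 - 1 < t by lra.
have iu : (@lebesgue_measure R).-integrable `[t0 - 1, t + 1] (EFin \o u).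
  apply: continuous_compact_integrable; first exact: segment_compact.
  exact: continuous_subspaceT.
have [dF F'] := @continuous_FTC1_closed R u (t0 - 1) t (t + 1) tt1 iu lt (cu t).
have hF : is_derive t 1
    (fun s => Rintegral lebesgue_measure `[t0 - 1, s] u) (u t).
  by apply: DeriveDef; [exact: dF|rewrite -derive1E; exact: F'].
by apply: (is_derive_eq (is_derive_sub hF (is_derive_const _ _))); rewrite subr0.
Qed.

Lemma lipschitz_continuous f (C : R) :
  (forall s t, `|f s - f t| <= C * `|s - t|) -> continuous f.
Proof.
move=> hC t; have C1 : 0 < `|C| + 1 by rewrite ltr_wpDl.
apply/cvgrPdist_lt => e e0; near=> s.
apply: le_lt_trans (hC t s) _.
apply: (@le_lt_trans _ _ ((`|C| + 1) * `|t - s|)).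
  by apply: ler_wpM2r => //; have := ler_norm C; lra.
rewrite mulrC -ltr_pdivlMr //.
near: s; apply: (@cvgr_dist_lt _ _ _ (nbhs t) _ id t) => //.
by rewrite divr_gt0.
Unshelve. all: by end_near. Qed.

Lemma le_of_geometric_slack (x y c : R) :
  (forall n, x <= y + c / 2 ^+ n) -> x <= y.
Proof.
move=> h; rewrite leNgt; apply/negP => yx.
have c0 : 0 < c by have := h 0; rewrite expr0 divr1; lra.
have [n hn] : exists n : nat, c / (x - y) < n%:R.
  exists (Num.bound (c / (x - y))); apply: archi_boundP.
  by rewrite divr_ge0 ?subr_ge0 ?ltW.
have n2 : (n%:R : R) <= 2 ^+ n by rewrite -natrX ler_nat ltnW // ltn_expl.
have := h n; apply/negP; rewrite -ltNge.
have : c < (x - y) * 2 ^+ n.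
  by rewrite mulrC -ltr_pdivrMr ?subr_gt0 //; exact: lt_le_trans hn n2.
by rewrite -ltr_pdivrMr ?exprn_gt0 //; lra.
Qed.

(** Produces a limit together with its rate of convergence: when lo is
    nondecreasing, hi is nonincreasing and hi - lo tends to 0, the point l is
    their common limit. *)
Lemma sup_between (T : Type) (x0 : T) (lo hi : T -> R) :
  (forall x y, lo x <= hi y) -> exists l, forall x, lo x <= l <= hi x.
Proof.
move=> lohi; exists (sup (range lo)) => x; apply/andP; split.
  apply: ub_le_sup; last by exists x.
  by exists (hi x0) => _ [y _ <-].
apply: ge_sup; first by exists (lo x0), x0.
by move=> _ [y _ <-].
Qed.

Lemma geometric_limit (u : nat -> R) (c : R) :
  (forall n, `|u n.+1 - u n| <= c / 2 ^+ n) ->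
  exists l, forall n, `|u n - l| <= 2 * c / 2 ^+ n.
Proof.
move=> hu.
pose r n : R := 2 * c / 2 ^+ n.
have rS n : r n - r n.+1 = c / 2 ^+ n.
  by rewrite /r exprS; field; rewrite expf_neq0.
have c0 : 0 <= c.
  by have := hu 0; rewrite expr0 divr1; exact: le_trans.
have r0 n : 0 <= r n by rewrite divr_ge0 ?exprn_ge0 ?mulr_ge0.
have step n m : u n - r n <= u (n + m)%N - r (n + m)%N /\
    u (n + m)%N + r (n + m)%N <= u n + r n.
  elim: m => [|m [IH1 IH2]]; first by rewrite addn0.
  have := hu (n + m)%N; rewrite -rS addnS ler_norml => /andP[]; lra.
have [|l hl] := @sup_between nat 0 (fun n => u n - r n) (fun n => u n + r n).
  move=> n m; have [h1 _] := step n m; have [_] := step m n; rewrite addnC.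
  by have := r0 (n + m)%N; lra.
exists l => n; rewrite -/(r n) ler_norml.
by have /andP[] := hl n; move=> ? ?; apply/andP; split; lra.
Qed.

End Calculus.

(** * Picard iteration for a bounded, globally Lipschitz vector field *)

Section Picard.
Context {R : realType} {J : Type}.
Implicit Types (u v : J -> R).

(** Lipschitz continuity for the sup distance, phrased through bounds e on all
    coordinate differences so that no supremum over J is needed. *)
Definition lipschitz_with (L : R) (h : (J -> R) -> R) : Prop :=
  forall u v e, (forall j, `|u j - v j| <= e) -> `|h u - h v| <= L * e.

(** In the norm weighted by exp (2 L (t - t0)), integrating a field with Lipschitz
    constant L halves distances, whatever the length of the time interval; hence
    existence and uniqueness on the half-line without any continuation. *)
Lemma picard_contraction (g : (J -> R) -> J -> R) (L K t0 : R)
    (a b p q : J -> R -> R) : 0 < L ->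
  (forall j, lipschitz_with L (g^~ j)) ->
  (forall j, a j t0 = b j t0) ->
  (forall t j, t0 <= t -> is_derive t 1 (a j) (g (p^~ t) j)) ->
  (forall t j, t0 <= t -> is_derive t 1 (b j) (g (q^~ t) j)) ->
  (forall t j, t0 <= t -> `|p j t - q j t| <= K * expR (2 * L * (t - t0))) ->
  forall t j, t0 <= t -> `|a j t - b j t| <= K / 2 * expR (2 * L * (t - t0)).
Proof.
move=> L0 gL ab ha hb pq t j t0t.
have K0 : 0 <= K.
  by have := pq _ j (lexx t0); rewrite subrr mulr0 expR0 mulr1; exact: le_trans.
have h := @increment_le_dominated R (fun s => a j s - b j s)
  (fun s => g (p^~ s) j - g (q^~ s) j)
  (fun s => K / 2 * expR (2 * L * (s - t0)))
  (fun s => K / 2 * (2 * L * expR (2 * L * (s - t0)))) t0 t t0t.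
have {h} := h _ _ _; rewrite /= ab !subrr mulr0 expR0 mulr1 subr0 => h.
apply: le_trans (h _ _ _) _.
- by move=> s /andP[t0s _]; apply: is_derive_sub; [exact: ha|exact: hb].
- by move=> s _; apply: is_derive_scale; exact: is_derive_expR_affine.
- move=> s /andP[t0s _]; apply: le_trans (gL j _ _ _ (pq s ^~ t0s)) _.
  by rewrite le_eqVlt; apply/orP; left; apply/eqP; field.
- by rewrite gerBl divr_ge0.
Qed.

Lemma picard_unique (g : (J -> R) -> J -> R) (L K t0 : R)
    (a b : J -> R -> R) : 0 < L ->
  (forall j, lipschitz_with L (g^~ j)) ->
  (forall j, a j t0 = b j t0) ->
  (forall t j, t0 <= t -> is_derive t 1 (a j) (g (a^~ t) j)) ->
  (forall t j, t0 <= t -> is_derive t 1 (b j) (g (b^~ t) j)) ->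
  (forall t j, t0 <= t -> `|a j t - b j t| <= K) ->
  forall t j, t0 <= t -> a j t = b j t.
Proof.
move=> L0 gL ab ha hb hK t j t0t.
have h n : forall t j, t0 <= t ->
    `|a j t - b j t| <= K / 2 ^+ n * expR (2 * L * (t - t0)).
  elim: n => [s i t0s|n IH].
    rewrite expr0 divr1; apply: le_trans (hK s i t0s) _.
    apply: ler_peMr; first exact: le_trans (hK s i t0s).
    by rewrite -expR0 ler_expR mulr_ge0 ?subr_ge0 // mulr_ge0 // ltW.
  move=> s i t0s; rewrite exprSr invfM mulrA.
  exact: (picard_contraction L0 gL ab ha hb IH).
apply/eqP; rewrite -subr_eq0 -normr_le0.
apply: (@le_of_geometric_slack _ _ _ (K * expR (2 * L * (t - t0)))) => n.
by rewrite add0r mulrAC; exact: h.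
Qed.

Section Existence.
Variables (g : (J -> R) -> J -> R) (B L t0 : R) (u0 : J -> R).
Hypothesis L0 : 0 < L.
Hypothesis gB : forall u j, `|g u j| <= B.
Hypothesis gL : forall j, lipschitz_with L (g^~ j).

(** Time is cut off at t0 because the iterates are controlled for t >= t0 only,
    while the primitive needs an integrand that is continuous everywhere. *)
Definition picard_step (p : J -> R -> R) (j : J) (t : R) : R :=
  u0 j + primitive t0 (fun s => g (fun i => p i (Num.max t0 s)) j) t.

Let lip_after (p : J -> R -> R) :=
  forall j s t, t0 <= s -> t0 <= t -> `|p j s - p j t| <= B * `|s - t|.

Let picard_step0 p j : picard_step p j t0 = u0 j.
Proof. by rewrite /picard_step /primitive subrr addr0. Qed.

Let is_derive_picard_step p : lip_after p -> forall t j, t0 <= t ->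
  is_derive t 1 (picard_step p j) (g (p^~ t) j).
Proof.
move=> hp t j t0t.
have cu : continuous (fun s => g (fun i => p i (Num.max t0 s)) j).
  have B0 : 0 <= B by apply: le_trans (gB (p^~ t0) j).
  apply: (@lipschitz_continuous _ _ (L * B)) => r s; rewrite -mulrA; apply: gL => i.
  apply: le_trans (hp i _ _ _ _) _; rewrite ?le_max ?lexx //.
  apply: ler_wpM2l => //.
  by rewrite /Num.max; case: (ltP t0 r); case: (ltP t0 s) => hs hr;
    rewrite !ler_norml; apply/andP; split; have := ler_norm (r - s);
    have := ler_norm (s - r); rewrite (distrC s r); lra.
have := is_derive_primitive cu t0t; rewrite (max_idPr t0t) => hd.
by apply: (is_derive_eq (is_derive_add (is_derive_const (u0 j) t) hd)); rewrite add0r.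
Qed.

Let lip_picard_step p : lip_after p -> lip_after (picard_step p).
Proof.
move=> hp j.
have h s t : t0 <= s -> s <= t ->
    `|picard_step p j t - picard_step p j s| <= B * (t - s).
  move=> t0s st; rewrite mulrBr.
  apply: (increment_le_dominated st (df := fun r => g (p^~ r) j)
    (g := fun r => B * r) (dg := fun=> B * 1)) => r /andP[sr _].
  - by apply: is_derive_picard_step => //; exact: le_trans sr.
  - by rewrite mulr1.
move=> s t t0s t0t; case: (leP s t) => [st|/ltW ts].
  by rewrite distrC (distrC s t) (@ger0_norm _ (t - s)) ?subr_ge0 //; exact: h.
by rewrite (@ger0_norm _ (s - t)) ?subr_ge0 //; exact: h.
Qed.

(** The iterates form a Cauchy sequence at a geometric rate.  They all have
    Lipschitz constant B, which their pointwise limit inherits: its image under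
    the vector field is continuous without any appeal to uniform convergence. *)
Lemma picard_exists : exists z : J -> R -> R, (forall j, z j t0 = u0 j) /\
  forall t j, t0 <= t -> is_derive t 1 (z j) (g (z^~ t) j).
Proof.
pose p n := iter n picard_step (fun j _ => u0 j).
have [/asboolP J0|/asboolP/existsNP[j0 _]] :=
    boolP `[< forall j : J, False >]; first by exists (p 0); split=> // ? j.
have B0 : 0 <= B by apply: le_trans (gB (p 0 ^~ t0) j0).
have lp n : lip_after (p n).
  elim: n => [|n IH]; last exact: lip_picard_step.
  by move=> j s t _ _; rewrite subrr normr0 mulr_ge0.
pose K := B / (2 * L).
have dp n t j : t0 <= t ->
    `|p n.+1 j t - p n j t| <= K / 2 ^+ n * expR (2 * L * (t - t0)).
  elim: n t j => [t j t0t|n IH t j t0t].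
    have := lp 1 j t t0 t0t (lexx _); rewrite {2}/p /= picard_step0 => h.
    apply: (le_trans h); rewrite expr0 divr1 ger0_norm ?subr_ge0 //.
    have -> : B * (t - t0) = K * (2 * L * (t - t0)).
      by rewrite /K; field; rewrite gt_eqF.
    apply: ler_wpM2l; first by rewrite divr_ge0 // mulr_ge0 // ltW.
    by have := expR_ge1Dx (2 * L * (t - t0)); lra.
  rewrite exprSr invfM mulrA.
  apply: (picard_contraction L0 gL _ _ _ IH) => //.
  - move=> i; rewrite /p iterS picard_step0.
    by case: (n) => [|m]; rewrite ?iterS ?picard_step0.
  - exact: is_derive_picard_step (lp n.+1).
  - exact: is_derive_picard_step (lp n).
have zex (jt : J * R) : exists l, t0 <= jt.2 -> forall n,
    `|p n jt.1 jt.2 - l| <= 2 * K / 2 ^+ n * expR (2 * L * (jt.2 - t0)).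
  case: jt => j t /=; case: (leP t0 t) => t0t; last by exists 0.
  have [|l hl] := @geometric_limit R (fun n => p n j t)
      (K * expR (2 * L * (t - t0))).
    by move=> n; rewrite mulrAC; exact: dp.
  by exists l => _ n; have := hl n; rewrite mulrA mulrAC.
have [z0 hz0] := choice zex.
pose z j t := z0 (j, t).
have hz n t j : t0 <= t ->
    `|p n j t - z j t| <= 2 * K / 2 ^+ n * expR (2 * L * (t - t0)).
  by move=> t0t; exact: (hz0 (j, t)).
have lz : lip_after z.
  move=> j s t t0s t0t.
  apply: (@le_of_geometric_slack _ _ _ (2 * K * expR (2 * L * (s - t0))
    + 2 * K * expR (2 * L * (t - t0)))) => n.
  have := hz n s j t0s; have := hz n t j t0t; have := lp n j s t t0s t0t.
  set es := expR _; set et := expR _; set n2 := _ ^- n.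
  have -> : (2 * K * et + 2 * K * es) * n2
    = 2 * K * n2 * et + 2 * K * n2 * es by ring.
  rewrite !ler_norml => /andP[? ?] /andP[? ?] /andP[? ?].
  by apply/andP; split; lra.
(* Both sides are the limit of the iterates: picard_step halves the distance
   between the n-th iterate and z. *)
have zE t j : t0 <= t -> picard_step z j t = z j t.
  move=> t0t; apply/eqP; rewrite -subr_eq0 -normr_le0.
  apply: (@le_of_geometric_slack _ _ _ (2 * K * expR (2 * L * (t - t0)))) => n.
  have h1 : `|picard_step (p n) j t - picard_step z j t| <=
      2 * K / 2 ^+ n / 2 * expR (2 * L * (t - t0)).
    apply: (picard_contraction L0 gL (p := p n) (q := z)) => //.
    - by move=> i; rewrite !picard_step0.
    - exact: is_derive_picard_step (lp n).
    - exact: is_derive_picard_step lz.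
    - by move=> s i; exact: hz.
  have := hz n.+1 t j t0t; move: h1; rewrite add0r exprSr invfM mulrA.
  rewrite [X in _ -> _ -> _ <= X]mulrAC /p iterS -/(p n).
  rewrite !ler_norml => /andP[? ?] /andP[? ?].
  by apply/andP; split; lra.
exists (picard_step z); split => [j|t j t0t]; first exact: picard_step0.
have -> : (fun j => picard_step z j t) = z^~ t.
  by apply/funext => i; exact: zE.
exact: is_derive_picard_step.
Qed.

End Existence.

End Picard.

(** * Coordinates on the state space *)

Section Coordinates.
Context {R : realType}.

Lemma ord3P (P : 'I_3 -> Prop) : P 0 -> P 1 -> P 2 -> forall i, P i.
Proof.
move=> P0 P1 P2 [[|[|[|//]]] h].
- by have -> : Ordinal h = 0 by apply/val_inj.
- by have -> : Ordinal h = 1 by apply/val_inj.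
- by have -> : Ordinal h = 2 by apply/val_inj.
Qed.

Lemma sum3 (F : 'I_3 -> R) : \sum_(i < 3) F i = F 0 + F 1 + F 2.
Proof.
rewrite !big_ord_recl big_ord0 addr0 addrA; congr (_ + F _ + F _); exact/val_inj.
Qed.

Lemma is_derive_sum3 (F : 'I_3 -> R -> R) (a : 'I_3 -> R) (t : R) :
  (forall i, is_derive t 1 (F i) (a i)) ->
  is_derive t 1 (fun s => \sum_(i < 3) F i s) (\sum_(i < 3) a i).
Proof.
move=> h.
have -> : (fun s => \sum_(i < 3) F i s) = (fun s => F 0 s + F 1 s + F 2 s).
  by apply/funext => s; rewrite sum3.
by rewrite sum3; do 2!apply: is_derive_add.
Qed.

Definition component (z : state R) (j : 'I_3 + 'I_3) : R :=
  match j with inl i => z.1 i 0 | inr i => z.2 i 0 end.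

Definition of_components (u : 'I_3 + 'I_3 -> R) : state R :=
  (\col_i u (inl i), \col_i u (inr i)).

Lemma of_componentsK u : component (of_components u) = u.
Proof. by apply/funext => -[i|i]; rewrite /= mxE. Qed.

Lemma component_inj (z1 z2 : state R) : component z1 =1 component z2 -> z1 = z2.
Proof.
case: z1 z2 => [a1 b1] [a2 b2] h; congr pair; apply/colP => i.
  exact: (h (inl i)).
exact: (h (inr i)).
Qed.

Lemma componentB z1 z2 j : component (z1 - z2) j = component z1 j - component z2 j.
Proof. by case: j => i; rewrite /= !mxE. Qed.

Lemma component_le_enorm z j : `|component z j| <= enorm z.
Proof.
rewrite -sqrtr_sqr; apply: ler_wsqrtr; rewrite !sum3.
have p0 := sqr_ge0 (z.1 0 0); have p1 := sqr_ge0 (z.1 1 0).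
have p2 := sqr_ge0 (z.1 2 0); have q0 := sqr_ge0 (z.2 0 0).
have q1 := sqr_ge0 (z.2 1 0); have q2 := sqr_ge0 (z.2 2 0).
by case: j => i; elim/ord3P: i => /=; lra.
Qed.

Lemma enorm_le z e : (forall j, `|component z j| <= e) -> enorm z <= 3 * e.
Proof.
move=> h; have e0 : 0 <= e by apply: le_trans (h (inl 0)).
have h2 j : component z j ^+ 2 <= e ^+ 2.
  by have := h j; rewrite ler_norml => /andP[? ?]; nra.
have e3 : 0 <= 3 * e by rewrite mulr_ge0.
rewrite -[3 * e]ger0_norm // -sqrtr_sqr; apply: ler_wsqrtr; rewrite !sum3.
have := h2 (inl 0); have := h2 (inl 1); have := h2 (inl 2).
have := h2 (inr 0); have := h2 (inr 1); have := h2 (inr 2) => /=.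
have := sqr_ge0 e; rewrite exprMn; lra.
Qed.

End Coordinates.

(** * Elementary inequalities *)

Section Inequalities.
Context {R : realDomainType}.
Implicit Types a b p q : R.

Lemma norm_mul_le a b p q : `|a| <= p -> `|b| <= q -> `|a * b| <= p * q.
Proof. by move=> ha hb; rewrite normrM ler_pM. Qed.

Lemma norm_add_le a b p q : `|a| <= p -> `|b| <= q -> `|a + b| <= p + q.
Proof. by move=> ha hb; apply: le_trans (ler_normD _ _) (lerD ha hb). Qed.

Lemma norm_sub_le a b p q : `|a| <= p -> `|b| <= q -> `|a - b| <= p + q.
Proof. by move=> ha hb; apply: le_trans (ler_normB _ _) (lerD ha hb). Qed.

Lemma norm_scale_le a b q : 0 <= a -> `|b| <= q -> `|a * b| <= a * q.
Proof. by move=> ha; apply: norm_mul_le; rewrite ger0_norm. Qed.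

Lemma sqr_le_of_norm a p : `|a| <= p -> a ^+ 2 <= p ^+ 2.
Proof. by rewrite ler_norml => /andP[? ?]; nra. Qed.

Lemma sqr_sum3_le a b c : (a + b + c) ^+ 2 <= 3 * (a ^+ 2 + b ^+ 2 + c ^+ 2).
Proof.
have := sqr_ge0 (a - b); have := sqr_ge0 (b - c); have := sqr_ge0 (a - c).
by rewrite !sqrrB !expr2; lra.
Qed.

Lemma sqr_sum6_le a b c a' b' c' :
  (`|a| + `|b| + `|c| + (`|a'| + `|b'| + `|c'|)) ^+ 2
    <= 6 * (a ^+ 2 + b ^+ 2 + c ^+ 2 + (a' ^+ 2 + b' ^+ 2 + c' ^+ 2)).
Proof.
have := sqr_sum3_le `|a| `|b| `|c|; have := sqr_sum3_le `|a'| `|b'| `|c'|.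
rewrite !real_normK ?num_real //.
move: (a ^+ 2 + _ + _) (a' ^+ 2 + _ + _) => p q.
move: (`|a| + _ + _) (`|a'| + _ + _) => s t hq hp.
have := sqr_ge0 (s - t); rewrite sqrrB sqrrD; move: hq hp.
by move: (s ^+ 2) (t ^+ 2) (s * t) => ss tt st; lra.
Qed.

End Inequalities.

(** The terms d_i r_i are at most C S (S + T) in total, where S and T are the sums
    of the |d_i| and |n_i|.  Young's inequality, in the form
    (T - 3 a C S)^2 >= 0, absorbs C S T into half of |n|^2 / a and a multiple of
    |d|^2. *)
Lemma young_sum {R : realFieldType} (d1 d2 d3 n1 n2 n3 r1 r2 r3 C a : R) :
  let U := `|d1| + `|d2| + `|d3| + (`|n1| + `|n2| + `|n3|) in
  0 <= C -> 0 < a -> `|r1| <= C * U -> `|r2| <= C * U -> `|r3| <= C * U ->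
  d1 * r1 + d2 * r2 + d3 * r3
    <= (n1 ^+ 2 + n2 ^+ 2 + n3 ^+ 2) / (2 * a)
       + (3 * C + 9 / 2 * a * C ^+ 2) * (d1 ^+ 2 + d2 ^+ 2 + d3 ^+ 2).
Proof.
move=> U C0 a0 h1 h2 h3.
pose S := `|d1| + `|d2| + `|d3|; pose T := `|n1| + `|n2| + `|n3|.
have le1 d r : `|r| <= C * U -> d * r <= `|d| * (C * U).
  by move=> h; apply: le_trans (ler_norm _) _; exact: norm_mul_le.
have hS : S ^+ 2 <= 3 * (d1 ^+ 2 + d2 ^+ 2 + d3 ^+ 2).
  by apply: le_trans (sqr_sum3_le _ _ _) _; rewrite !real_normK ?num_real.
have hT : T ^+ 2 <= 3 * (n1 ^+ 2 + n2 ^+ 2 + n3 ^+ 2).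
  by apply: le_trans (sqr_sum3_le _ _ _) _; rewrite !real_normK ?num_real.
have hST : C * S * T <= T ^+ 2 / (6 * a) + 3 / 2 * a * C ^+ 2 * S ^+ 2.
  have : 0 <= (T - 3 * a * C * S) ^+ 2 / (6 * a).
    by rewrite divr_ge0 ?sqr_ge0 // mulr_ge0 // ltW.
  have -> : (T - 3 * a * C * S) ^+ 2 / (6 * a)
    = T ^+ 2 / (6 * a) + 3 / 2 * a * C ^+ 2 * S ^+ 2 - C * S * T.
    by field; rewrite gt_eqF.
  by lra.
have sumle : d1 * r1 + d2 * r2 + d3 * r3 <= C * S ^+ 2 + C * S * T.
  have := le1 d1 _ h1; have := le1 d2 _ h2; have := le1 d3 _ h3.
  have -> : C * S ^+ 2 + C * S * T = S * (C * U) by rewrite /U -/S -/T; ring.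
  by rewrite /S; lra.
have hT' : T ^+ 2 / (6 * a) <= (n1 ^+ 2 + n2 ^+ 2 + n3 ^+ 2) / (2 * a).
  have -> : (n1 ^+ 2 + n2 ^+ 2 + n3 ^+ 2) / (2 * a)
    = 3 * (n1 ^+ 2 + n2 ^+ 2 + n3 ^+ 2) / (6 * a) by field; rewrite gt_eqF.
  by rewrite ler_pM2r // invr_gt0 mulr_gt0.
have := ler_wpM2l C0 hS.
have aC : 0 <= 3 / 2 * a * C ^+ 2.
  by rewrite mulr_ge0 ?sqr_ge0 // mulr_ge0 ?ltW.
have := ler_wpM2l aC hS.
move: hST hT' sumle; set u := _ / (2 * a); set v := _ / (6 * a).
by set D := d1 ^+ 2 + _ + _; lra.
Qed.

(** * The Lyapunov function *)

Section RigidBody.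
Context {R : realType}.
Variables k I A1 A2 A3 : R.
Hypotheses (k0 : 0 < k) (I0 : 0 < I) (A10 : 0 < A1) (A12 : A1 <= A2)
  (A23 : A2 <= A3).

Let A20 : 0 < A2. Proof. exact: lt_le_trans A12. Qed.
Let A30 : 0 < A3. Proof. exact: lt_le_trans A23. Qed.

Local Notation J := (inertia A1 A2 A3).
Local Notation f := (rhs k I J).

Lemma inertia_mulE (v : 'cV[R]_3) i :
  (J *m v) i 0 = [:: A1; A2; A3]`_i * v i 0.
Proof. by rewrite /inertia mul_diag_mx !mxE. Qed.

Lemma inertia_invE (v : 'cV[R]_3) i :
  (invmx J *m v) i 0 = v i 0 / [:: A1; A2; A3]`_i.
Proof.
have nz j : [:: A1; A2; A3]`_(nat_of_ord (j : 'I_3)) != 0.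
  by elim/ord3P: j; rewrite /= gt_eqF.
have uJ : J \in unitmx.
  rewrite unitmxE unitfE det_diag; apply/prodf_neq0 => j _.
  by rewrite !mxE nz.
have -> : v = J *m (\col_j (v j 0 / [:: A1; A2; A3]`_j)).
  by apply/colP => j; rewrite inertia_mulE mxE mulrC divfK.
by rewrite mulKmx // inertia_mulE !mxE; congr (_ / _); rewrite mulrC divfK.
Qed.

Definition gyro (z : state R) : 'cV[R]_3 := crossmul z.1 (J *m z.1).

Lemma rhs1E z i : (f z).1 i 0
  = (k * (z.2 i 0 - z.1 i 0) - gyro z i 0) / [:: A1; A2; A3]`_i.
Proof. by rewrite /= inertia_invE !mxE. Qed.

Lemma rhs2E z i : (f z).2 i 0
  = - (k / I * (z.2 i 0 - z.1 i 0)) - crossmul z.1 z.2 i 0.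
Proof. by rewrite /= !mxE. Qed.

Lemma crossmul_rec (u v : 'cV[R]_3) :
  ((crossmul u v 0 0 = u 1 0 * v 2 0 - u 2 0 * v 1 0)%R *
   (crossmul u v 1 0 = u 2 0 * v 0 0 - u 0 0 * v 2 0)%R *
   (crossmul u v 2 0 = u 0 0 * v 1 0 - u 1 0 * v 0 0)%R)%type.
Proof. by rewrite !mxE. Qed.

Lemma gyroE z : ((gyro z 0 0 = (A3 - A2) * (z.1 1 0 * z.1 2 0))%R *
  (gyro z 1 0 = (A1 - A3) * (z.1 2 0 * z.1 0 0))%R *
  (gyro z 2 0 = (A2 - A1) * (z.1 0 0 * z.1 1 0))%R)%type.
Proof. by rewrite /gyro !crossmul_rec !inertia_mulE /=; do !split; ring. Qed.

Definition slip2 (z : state R) : R := \sum_(i < 3) (z.2 i 0 - z.1 i 0) ^+ 2.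
Definition gyro2 (z : state R) : R := \sum_(i < 3) gyro z i 0 ^+ 2.

Definition residual (z : state R) : R := slip2 z + gyro2 z.

Lemma residual_ge0 z : 0 <= residual z.
Proof. by rewrite addr_ge0 //; apply: sumr_ge0 => i _; exact: sqr_ge0. Qed.

(** This is (lam + I) 2E - |J x + I y|^2, rearranged with the help of
    (A + I) (A x^2 + I y^2) - (A x + I y)^2 = A I (y - x)^2 so that its sign is
    visible when lam = A3. *)
Definition excess (lam : R) (z : state R) : R :=
  \sum_(i < 3) ((lam - [:: A1; A2; A3]`_i)
                  * ([:: A1; A2; A3]`_i * z.1 i 0 ^+ 2 + I * z.2 i 0 ^+ 2)
                + [:: A1; A2; A3]`_i * I * (z.2 i 0 - z.1 i 0) ^+ 2).

(** The minus sign makes the derivative contain - n . J^-1 n, since J^-1 n appears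
    with a plus sign in the derivative of d. *)
Definition mixed (z : state R) : R :=
  - \sum_(i < 3) (z.2 i 0 - z.1 i 0) * gyro z i 0.

(** The computations below are about real numbers: x_i and y_i are the coordinates
    of the two angular velocities, d_i and n_i those of the slip and of the
    gyroscopic torque, p_i and q_i the time derivatives of x_i and y_i. *)
Section Estimates.
Variables x1 x2 x3 y1 y2 y3 : R.
Local Notation d1 := (y1 - x1).
Local Notation d2 := (y2 - x2).
Local Notation d3 := (y3 - x3).
Local Notation n1 := ((A3 - A2) * (x2 * x3)).
Local Notation n2 := ((A1 - A3) * (x3 * x1)).
Local Notation n3 := ((A2 - A1) * (x1 * x2)).
Local Notation p1 := ((k * d1 - n1) / A1).
Local Notation p2 := ((k * d2 - n2) / A2).
Local Notation p3 := ((k * d3 - n3) / A3).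
Local Notation q1 := (- (k / I * d1) - (x2 * y3 - x3 * y2)).
Local Notation q2 := (- (k / I * d2) - (x3 * y1 - x1 * y3)).
Local Notation q3 := (- (k / I * d3) - (x1 * y2 - x2 * y1)).

(** All the cubic terms cancel, as the energy loses k |d|^2 per unit of time and
    the angular momentum is merely rotated. *)
Lemma excess_rate lam :
    ((lam - A1) * (A1 * (2 * x1 * p1) + I * (2 * y1 * q1))
       + A1 * I * (2 * d1 * (q1 - p1)))
  + ((lam - A2) * (A2 * (2 * x2 * p2) + I * (2 * y2 * q2))
       + A2 * I * (2 * d2 * (q2 - p2)))
  + ((lam - A3) * (A3 * (2 * x3 * p3) + I * (2 * y3 * q3))
       + A3 * I * (2 * d3 * (q3 - p3)))
  = - (2 * k * (lam + I) * (d1 ^+ 2 + d2 ^+ 2 + d3 ^+ 2)).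
Proof. by field; rewrite !gt_eqF. Qed.

Local Notation r1 := ((k / I + k / A1) * n1 + (n2 * x3 - n3 * x2)
  - (A3 - A2) * (x2 * p3 + x3 * p2)).
Local Notation r2 := ((k / I + k / A2) * n2 + (n3 * x1 - n1 * x3)
  - (A1 - A3) * (x3 * p1 + x1 * p3)).
Local Notation r3 := ((k / I + k / A3) * n3 + (n1 * x2 - n2 * x1)
  - (A2 - A1) * (x1 * p2 + x2 * p1)).

(** The point of this rearrangement is that, apart from - n . J^-1 n, every term
    has a factor d_i.  For the term (x cross d) . n, which comes from the
    derivative of y, this is the identity (x cross d) . n = d . (n cross x). *)
Lemma mixed_rate :
  - ((d1 * ((A3 - A2) * (x2 * p3 + x3 * p2)) + n1 * (q1 - p1))
   + (d2 * ((A1 - A3) * (x3 * p1 + x1 * p3)) + n2 * (q2 - p2))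
   + (d3 * ((A2 - A1) * (x1 * p2 + x2 * p1)) + n3 * (q3 - p3)))
  = - (n1 ^+ 2 / A1 + n2 ^+ 2 / A2 + n3 ^+ 2 / A3)
    + (d1 * r1 + d2 * r2 + d3 * r3).
Proof. by field; rewrite !gt_eqF. Qed.

Section Bounded.
Variable M : R.
Hypotheses (hx1 : `|x1| <= M) (hx2 : `|x2| <= M) (hx3 : `|x3| <= M).
Local Notation U := (`|d1| + `|d2| + `|d3| + (`|n1| + `|n2| + `|n3|)).

Definition accel_const : R := (k + 1) / A1.
Definition cross_const : R :=
  k / I + k / A1 + 2 * M + 2 * A3 * (M * accel_const).

Let M0 : 0 <= M. Proof. exact: le_trans hx1. Qed.

Lemma accel_const_ge0 : 0 <= accel_const.
Proof. by rewrite divr_ge0 ?addr_ge0 ?ltW. Qed.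

Lemma accel_le A d n u : A1 <= A -> `|d| <= u -> `|n| <= u ->
  `|(k * d - n) / A| <= accel_const * u.
Proof.
move=> hA hd hn; have A0 : 0 < A by exact: lt_le_trans hA.
have -> : accel_const * u = (k * u + u) * A1^-1 by rewrite /accel_const; ring.
apply: norm_mul_le.
  by apply: norm_sub_le => //; apply: norm_scale_le => //; exact: ltW.
by rewrite ger0_norm ?invr_ge0 ?(ltW A0) // lef_pV2 ?posrE.
Qed.

Lemma cross_term_le A a n n' n'' x' x'' p' p'' u :
  A1 <= A -> `|a| <= A3 -> `|n| <= u -> `|n'| <= u -> `|n''| <= u ->
  `|x'| <= M -> `|x''| <= M ->
  `|p'| <= accel_const * u -> `|p''| <= accel_const * u ->
  `|(k / I + k / A) * n + (n' * x'' - n'' * x') - a * (x' * p'' + x'' * p')|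
    <= cross_const * u.
Proof.
move=> hA ha hn hn' hn'' hx' hx'' hp' hp''.
have A0 : 0 < A by exact: lt_le_trans hA.
have -> : cross_const * u = (k / I + k / A1) * u + (u * M + u * M)
    + A3 * (M * (accel_const * u) + M * (accel_const * u)).
  by rewrite /cross_const; ring.
apply: norm_sub_le.
  apply: norm_add_le; last by apply: norm_sub_le; apply: norm_mul_le.
  apply: norm_mul_le => //.
  rewrite ger0_norm; last by rewrite addr_ge0 // divr_ge0 // ltW.
  by rewrite lerD2l ler_pM2l // lef_pV2 ?posrE.
by apply: norm_mul_le => //; apply: norm_add_le; apply: norm_mul_le.
Qed.

Let dU : [/\ `|d1| <= U, `|d2| <= U & `|d3| <= U].
Proof.
have := normr_ge0 d1; have := normr_ge0 d2; have := normr_ge0 d3.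
have := normr_ge0 n1; have := normr_ge0 n2; have := normr_ge0 n3.
by split; lra.
Qed.

Let nU : [/\ `|n1| <= U, `|n2| <= U & `|n3| <= U].
Proof.
have := normr_ge0 d1; have := normr_ge0 d2; have := normr_ge0 d3.
have := normr_ge0 n1; have := normr_ge0 n2; have := normr_ge0 n3.
by split; lra.
Qed.

Lemma accels_le : [/\ `|p1| <= accel_const * U, `|p2| <= accel_const * U
  & `|p3| <= accel_const * U].
Proof.
have [? ? ?] := dU; have [? ? ?] := nU.
by split; apply: accel_le => //; exact: le_trans A23.
Qed.

Lemma mixed_rate_le :
  - ((d1 * ((A3 - A2) * (x2 * p3 + x3 * p2)) + n1 * (q1 - p1))
   + (d2 * ((A1 - A3) * (x3 * p1 + x1 * p3)) + n2 * (q2 - p2))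
   + (d3 * ((A2 - A1) * (x1 * p2 + x2 * p1)) + n3 * (q3 - p3)))
  <= - ((n1 ^+ 2 + n2 ^+ 2 + n3 ^+ 2) / (2 * A3))
    + (3 * cross_const + 9 / 2 * A3 * cross_const ^+ 2)
      * (d1 ^+ 2 + d2 ^+ 2 + d3 ^+ 2).
Proof.
rewrite mixed_rate.
have [? ? ?] := nU; have [? ? ?] := accels_le.
have C0 : 0 <= cross_const.
  have a0 := accel_const_ge0; have [kI kA] : 0 <= k / I /\ 0 <= k / A1.
    by split; apply: divr_ge0; exact: ltW.
  have A3M : 0 <= A3 * (M * accel_const).
    by apply: mulr_ge0; [exact: ltW|exact: mulr_ge0].
  rewrite /cross_const -[2 * A3 * _]mulrA; move: kI kA A3M M0.
  by move: (k / I) (k / A1) (A3 * _) => *; lra.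
have A13 := le_trans A12 A23.
have [a1 a2 a3] : [/\ `|A3 - A2| <= A3, `|A1 - A3| <= A3 & `|A2 - A1| <= A3].
  have := A20; have := A30; move: (A10) (A12) (A23) => *.
  by split; rewrite ler_norml; apply/andP; split; lra.
have hr1 : `|r1| <= cross_const * U by exact: cross_term_le.
have hr2 : `|r2| <= cross_const * U by exact: cross_term_le.
have hr3 : `|r3| <= cross_const * U by exact: cross_term_le.
apply: le_trans (lerD (lexx _) (young_sum C0 A30 hr1 hr2 hr3)) _.
rewrite addrA lerD2r.
have divA (n A : R) : 0 < A -> A <= A3 -> n ^+ 2 / A3 <= n ^+ 2 / A.
  by move=> A0 AA3; rewrite ler_wpM2l ?sqr_ge0 // lef_pV2 ?posrE.
have := divA n1 _ A10 A13; have := divA n2 _ A20 A23.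
have -> : (n1 ^+ 2 + n2 ^+ 2 + n3 ^+ 2) / (2 * A3)
  = (n1 ^+ 2 / A3 + n2 ^+ 2 / A3 + n3 ^+ 2 / A3) / 2.
  by field; rewrite gt_eqF.
move: (n1 ^+ 2 / A1) (n2 ^+ 2 / A2) (n1 ^+ 2 / A3) (n2 ^+ 2 / A3) (n3 ^+ 2 / A3).
by move=> *; lra.
Qed.

End Bounded.
End Estimates.

Definition bounded_by (M : R) (z : state R) : Prop :=
  forall j, `|component z j| <= M.

Definition near_point (rho : R) (p z : state R) : Prop :=
  forall j, `|component z j - component p j| <= rho.

Definition norm_bound (rho : R) (p : state R) : R := \sum_j `|component p j| + rho.

Lemma near_point_bounded rho p z :
  near_point rho p z -> bounded_by (norm_bound rho p) z.
Proof.
move=> hz j; rewrite -[component z j](subrK (component p j)) addrC.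
apply: norm_add_le; last exact: hz.
by rewrite (bigD1 j) //= lerDl sumr_ge0.
Qed.

Definition lyap (lam eps : R) (z : state R) : R := excess lam z + eps * mixed z.

Section AlongSolutions.
Variables (z : R -> state R) (t : R).
Hypothesis hz : forall j,
  is_derive t 1 (fun s => component (z s) j) (component (f (z t)) j).

Let hx i : is_derive t 1 (fun s => (z s).1 i 0) ((f (z t)).1 i 0).
Proof. exact: (hz (inl i)). Qed.

Let hy i : is_derive t 1 (fun s => (z s).2 i 0) ((f (z t)).2 i 0).
Proof. exact: (hz (inr i)). Qed.

Let hd i : is_derive t 1 (fun s => (z s).2 i 0 - (z s).1 i 0)
  ((f (z t)).2 i 0 - (f (z t)).1 i 0).
Proof. exact: is_derive_sub. Qed.

Lemma is_derive_excess lam :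
  is_derive t 1 (fun s => excess lam (z s)) (- (2 * k * (lam + I) * slip2 (z t))).
Proof.
have h (i : 'I_3) := is_derive_add
  (is_derive_scale (lam - [:: A1; A2; A3]`_i)
    (is_derive_add (is_derive_scale [:: A1; A2; A3]`_i (is_derive_sqr (hx i)))
       (is_derive_scale I (is_derive_sqr (hy i)))))
  (is_derive_scale ([:: A1; A2; A3]`_i * I) (is_derive_sqr (hd i))).
apply: (is_derive_eq (is_derive_sum3 h)); rewrite sum3.
rewrite !rhs1E !rhs2E !gyroE !crossmul_rec /slip2 sum3 -excess_rate /=.
by ring.
Qed.

Lemma is_derive_mixed_le M : exists2 dm,
  is_derive t 1 (fun s => mixed (z s)) dm &
  bounded_by M (z t) -> dm <= - (gyro2 (z t) / (2 * A3))
    + (3 * cross_const M + 9 / 2 * A3 * cross_const M ^+ 2) * slip2 (z t).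
Proof.
have g0 : is_derive t 1 (fun s => gyro (z s) 0 0) _ :=
  is_derive_congr (fun s => esym (gyroE (z s)).1.1)
    (is_derive_scale (A3 - A2) (is_derive_mul (hx 1) (hx 2))).
have g1 : is_derive t 1 (fun s => gyro (z s) 1 0) _ :=
  is_derive_congr (fun s => esym (gyroE (z s)).1.2)
    (is_derive_scale (A1 - A3) (is_derive_mul (hx 2) (hx 0))).
have g2 : is_derive t 1 (fun s => gyro (z s) 2 0) _ :=
  is_derive_congr (fun s => esym (gyroE (z s)).2)
    (is_derive_scale (A2 - A1) (is_derive_mul (hx 0) (hx 1))).
have hm := is_derive_opp (is_derive_add
  (is_derive_add (is_derive_mul (hd 0) g0) (is_derive_mul (hd 1) g1))
  (is_derive_mul (hd 2) g2)).
eexists; first exact: (is_derive_congr (fun s => esym (congr1 -%R (sum3 _))) hm).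
move=> bz; rewrite /gyro2 /slip2 !sum3 !gyroE.
have := @mixed_rate_le ((z t).1 0 0) ((z t).1 1 0) ((z t).1 2 0)
  ((z t).2 0 0) ((z t).2 1 0) ((z t).2 2 0) M
  (bz (inl 0)) (bz (inl 1)) (bz (inl 2)).
apply: le_trans; rewrite !rhs1E !rhs2E !gyroE !crossmul_rec /=.
by rewrite le_eqVlt; apply/orP; left; apply/eqP; ring.
Qed.

End AlongSolutions.

(** The mixed term costs at most C |d|^2, which the dissipation 2k (lam + I) |d|^2
    of the excess pays for once eps C <= k (lam + I).  The bound eps <= eps0
    leaves room for a comparison of lyap with the residual. *)
Lemma lyap_dissipation (lam M eps0 : R) : 0 < lam -> 0 < eps0 ->
  exists eps kap : R, [/\ 0 < eps, eps <= eps0, 0 < kap &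
    forall (z : R -> state R) (t : R),
      (forall j, is_derive t 1 (fun s => component (z s) j)
         (component (f (z t)) j)) ->
    exists2 dV, is_derive t 1 (fun s => lyap lam eps (z s)) dV &
      bounded_by M (z t) -> dV <= - kap * residual (z t)].
Proof.
move=> lam0 eps00.
pose C := 3 * cross_const M + 9 / 2 * A3 * cross_const M ^+ 2.
pose c := k * (lam + I); have c0 : 0 < c by rewrite mulr_gt0 ?addr_gt0.
have C1 : 0 < `|C| + 1 by rewrite ltr_wpDl.
pose eps := Num.min eps0 (c / (`|C| + 1)).
have e0 : 0 < eps by rewrite lt_min eps00 divr_gt0.
have eC : eps * C <= c.
  have : eps * (`|C| + 1) <= c by rewrite -ler_pdivlMr // ge_min lexx orbT.
  by apply: le_trans; rewrite ler_pM2l //; have := ler_norm C; lra.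
pose kap := Num.min c (eps / (2 * A3)).
exists eps, kap; split => //; first by rewrite ge_min lexx.
  by rewrite lt_min c0 divr_gt0 // mulr_gt0.
move=> z t hz; have [dm hdm dm_le] := is_derive_mixed_le hz M.
exists (- (2 * k * (lam + I) * slip2 (z t)) + eps * dm).
  exact: is_derive_add (is_derive_excess hz lam) (is_derive_scale eps hdm).
move=> bz; have {dm_le} := dm_le bz; rewrite -/C => dm_le.
have s0 : 0 <= slip2 (z t) by apply: sumr_ge0 => i _; exact: sqr_ge0.
have n0 : 0 <= gyro2 (z t) by apply: sumr_ge0 => i _; exact: sqr_ge0.
have h1 := ler_wpM2l (ltW e0) dm_le.
have h2 := ler_wpM2r s0 eC.
have h3 : kap * slip2 (z t) <= c * slip2 (z t).
  by rewrite ler_wpM2r // ge_min lexx.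
have h4 : kap * gyro2 (z t) <= eps / (2 * A3) * gyro2 (z t).
  by rewrite ler_wpM2r // ge_min lexx orbT.
have -> : 2 * k * (lam + I) = 2 * c by rewrite /c; ring.
have h5 : eps * (- (gyro2 (z t) / (2 * A3)) + C * slip2 (z t))
  = - (eps / (2 * A3) * gyro2 (z t)) + eps * C * slip2 (z t) by ring.
by move: h1; rewrite h5 /residual; move: h2 h3 h4; lra.
Qed.

Lemma mixed_le z : `|mixed z| <= residual z / 2.
Proof.
rewrite /residual /mixed normrN /slip2 /gyro2 -big_split mulr_suml.
apply: le_trans (ler_norm_sum _ _ _) _; apply: ler_sum => i _ /=.
move: (_ - _) (gyro z i 0) => a b.
have := sqr_ge0 (a - b); have := sqr_ge0 (a + b); rewrite !expr2 => h1 h2.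
by rewrite ler_norml; apply/andP; split; lra.
Qed.

(** The squared norm of (lam - J) x, which measures how far x is from the eigenspace
    of lam. *)
Definition offaxis2 (lam : R) (z : state R) : R :=
  \sum_(i < 3) ((lam - [:: A1; A2; A3]`_i) * z.1 i 0) ^+ 2.

Lemma eigenvector_coord lam (w : 'cV[R]_3) : eigenvector J lam w ->
  forall i : 'I_3, (lam - [:: A1; A2; A3]`_i) * w i 0 = 0.
Proof.
move=> [_ Jw] i; have := congr1 (fun v : 'cV[R]_3 => v i 0) Jw.
by rewrite inertia_mulE mxE mulrBl => ->; rewrite subrr.
Qed.

(** Lagrange's identity for n = x cross (J - lam) x. *)
Lemma gyro2_eq lam z : gyro2 z
  = (\sum_(i < 3) z.1 i 0 ^+ 2) * offaxis2 lam z
    - (\sum_(i < 3) z.1 i 0 * ((lam - [:: A1; A2; A3]`_i) * z.1 i 0)) ^+ 2.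
Proof. by rewrite /gyro2 /offaxis2 !sum3 !gyroE /=; ring. Qed.

(** With v = (lam - J) x and e = x - w, the identity w . v = 0 gives x . v = e . v,
    so that |n|^2 = |x|^2 |v|^2 - (e . v)^2 >= (|x|^2 - |e|^2) |v|^2.  For e small
    the factor |x|^2 - |e|^2 = |w|^2 + 2 w . e is at least |w|^2 / 2. *)
Lemma offaxis2_le_gyro2 lam (w : 'cV[R]_3) : eigenvector J lam w ->
  exists rho c : R, [/\ 0 < rho, 0 < c & forall z : state R,
    (forall i, `|z.1 i 0 - w i 0| <= rho) -> c * offaxis2 lam z <= gyro2 z].
Proof.
move=> eig; have w0 := eigenvector_coord eig.
pose w2 := \sum_(i < 3) w i 0 ^+ 2.
have w2p : 0 < w2.
  rewrite lt_def sumr_ge0 ?andbT => [|i _]; last exact: sqr_ge0.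
  apply/eqP => h; case/eqP: eig.1; apply/colP => i; rewrite mxE; apply/eqP.
  rewrite -sqrf_eq0; apply/eqP.
  exact: (psumr_eq0P (F := fun i => w i 0 ^+ 2) (fun i _ => sqr_ge0 _) h).
pose w1 := \sum_(i < 3) `|w i 0|.
have w1p : 0 <= w1 by exact: sumr_ge0.
exists (w2 / (4 * (w1 + 1))), (w2 / 2); split.
- by rewrite divr_gt0 // mulr_gt0 // ltr_wpDl.
- by rewrite divr_gt0.
move=> z hz; rewrite (gyro2_eq lam).
pose e i := z.1 i 0 - w i 0.
have we : - (w2 / 4) <= \sum_(i < 3) w i 0 * e i.
  rewrite -[leRHS]opprK lerN2; apply: le_trans (ler_norm _) _; rewrite normrN.
  apply: le_trans (ler_norm_sum _ _ _) _.
  apply: (@le_trans _ _ (w1 * (w2 / (4 * (w1 + 1))))).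
    by rewrite mulr_suml; apply: ler_sum => i _; exact: norm_mul_le (lexx _) (hz i).
  have -> : w2 / 4 = (w1 + 1) * (w2 / (4 * (w1 + 1))).
    by field; rewrite gt_eqF // ltr_wpDl.
  by rewrite ler_wpM2r ?lerDl // divr_ge0 ?ltW // mulr_gt0 // ltr_wpDl.
have cs : (\sum_(i < 3) z.1 i 0 * ((lam - [:: A1; A2; A3]`_i) * z.1 i 0)) ^+ 2
    <= (\sum_(i < 3) e i ^+ 2) * offaxis2 lam z.
  have -> : \sum_(i < 3) z.1 i 0 * ((lam - [:: A1; A2; A3]`_i) * z.1 i 0)
      = \sum_(i < 3) e i * ((lam - [:: A1; A2; A3]`_i) * z.1 i 0).
    apply: eq_bigr => i _; rewrite /e [RHS]mulrBl [w i 0 * _]mulrA.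
    by rewrite [w i 0 * _]mulrC w0 mul0r subr0.
  rewrite /offaxis2 !sum3.
  move: (e 0) (e 1) (e 2) (_ * z.1 0 0) (_ * z.1 1 0) (_ * z.1 2 0) => a b c u v t.
  rewrite -subr_ge0.
  have -> : (a ^+ 2 + b ^+ 2 + c ^+ 2) * (u ^+ 2 + v ^+ 2 + t ^+ 2)
     - (a * u + b * v + c * t) ^+ 2
     = (a * v - b * u) ^+ 2 + (a * t - c * u) ^+ 2 + (b * t - c * v) ^+ 2 by ring.
  by rewrite !addr_ge0 ?sqr_ge0.
have o0 : 0 <= offaxis2 lam z by apply: sumr_ge0 => i _; exact: sqr_ge0.
have xe : w2 / 2 <= \sum_(i < 3) z.1 i 0 ^+ 2 - \sum_(i < 3) e i ^+ 2.
  have -> : \sum_(i < 3) z.1 i 0 ^+ 2 - \sum_(i < 3) e i ^+ 2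
     = w2 + 2 * \sum_(i < 3) w i 0 * e i by rewrite /w2 /e !sum3; ring.
  by lra.
have := ler_wpM2r o0 xe; rewrite mulrBl; move: cs; lra.
Qed.

(** The excess contains lam - A_i linearly and offaxis2 contains its square.  These
    are comparable because the lam - A_i are finitely many fixed numbers, and the
    identity |a| = |a^-1| a^2 of aE below, where 0^-1 = 0, covers a = 0 too. *)
Lemma excess_le lam : exists2 C : R, 0 < C &
  forall z : state R, `|excess lam z| <= C * (slip2 z + offaxis2 lam z).
Proof.
pose c (i : 'I_3) := let A := [:: A1; A2; A3]`_i in let a := lam - A in
  `|a^-1| * (`|A| + 2 * I) + 2 * I * `|a| + `|A| * I.
have c0 i : 0 <= c i.
  have := ltW I0; rewrite /c => I0'.
  by rewrite !addr_ge0 // !mulr_ge0 ?addr_ge0 // mulr_ge0.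
exists (\sum_i c i + 1); first by rewrite ltr_wpDl // sumr_ge0.
move=> z; rewrite /slip2 /offaxis2 -big_split mulr_sumr.
apply: le_trans (ler_norm_sum _ _ _) _; apply: ler_sum => i _ /=.
apply: (@le_trans _ _ (c i * ((z.2 i 0 - z.1 i 0) ^+ 2
    + ((lam - [:: A1; A2; A3]`_i) * z.1 i 0) ^+ 2))); last first.
  rewrite ler_wpM2r ?addr_ge0 ?sqr_ge0 // (bigD1 i) //= -addrA lerDl.
  by rewrite addr_ge0 // sumr_ge0.
rewrite /c; move: (_`_i) (z.1 i 0) (z.2 i 0) => A x y.
set a := lam - A; set d := y - x.
have aE : `|a| = `|a^-1| * a ^+ 2.
  have [->|an0] := eqVneq a 0; first by rewrite normr0 expr0n mulr0.
  rewrite -[a ^+ 2]real_normK ?num_real // normfV expr2 mulrA.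
  by rewrite mulVf ?mul1r // normr_eq0.
have y2 : y ^+ 2 <= 2 * (x ^+ 2 + d ^+ 2).
  by have := sqr_ge0 (x - d); rewrite /d !expr2; lra.
have I0' := ltW I0.
have h1 : `|a * (A * x ^+ 2 + I * y ^+ 2)|
    <= `|a| * ((`|A| + 2 * I) * x ^+ 2 + 2 * I * d ^+ 2).
  apply: norm_mul_le => //.
  apply: (@le_trans _ _ (`|A| * x ^+ 2 + I * y ^+ 2)).
    apply: norm_add_le; first by rewrite normrM (ger0_norm (sqr_ge0 x)).
    by rewrite ger0_norm // mulr_ge0 // sqr_ge0.
  by have := ler_wpM2l I0' y2; lra.
have h2 : `|A * I * d ^+ 2| <= `|A| * I * d ^+ 2.
  by rewrite normrM (ger0_norm (sqr_ge0 d)) normrM (ger0_norm I0').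
apply: le_trans (norm_add_le h1 h2) _.
rewrite {1}mulrDr [`|a| * (_ * x ^+ 2)]mulrCA {1}aE.
have p1 : 0 <= `|a^-1| * (`|A| + 2 * I) * d ^+ 2.
  by rewrite mulr_ge0 ?sqr_ge0 // mulr_ge0 // addr_ge0 // mulr_ge0.
have p2 : 0 <= (2 * I * `|a| + `|A| * I) * (a * x) ^+ 2.
  by rewrite mulr_ge0 ?sqr_ge0 // addr_ge0 // mulr_ge0 // mulr_ge0.
rewrite -subr_ge0; apply: le_trans (addr_ge0 p1 p2) _.
by rewrite le_eqVlt; apply/orP; left; apply/eqP; ring.
Qed.

Lemma excess_ge z :
  A1 * I * slip2 z + A1 / A3 * offaxis2 A3 z <= excess A3 z.
Proof.
rewrite /slip2 /offaxis2 /excess !mulr_sumr -big_split.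
apply: ler_sum => i _ /=.
have [h1 h2] : A1 <= [:: A1; A2; A3]`_i /\ [:: A1; A2; A3]`_i <= A3.
  by elim/ord3P: i => /=; split => //; exact: le_trans A23.
move: (_`_i) h1 h2 (z.1 i 0) (z.2 i 0) => A h1 h2 x y.
have a0 : 0 <= A3 - A by rewrite subr_ge0.
have A0 : 0 < A by exact: lt_le_trans h1.
rewrite addrC lerD //; last first.
  by rewrite ler_wpM2r ?sqr_ge0 // ler_pM2r.
have -> : A1 / A3 * ((A3 - A) * x) ^+ 2
  = (A3 - A) * (A1 * ((A3 - A) / A3) * x ^+ 2).
  by field; rewrite gt_eqF.
apply: ler_wpM2l => //; rewrite -[leLHS]addr0; apply: lerD; last first.
  by rewrite mulr_ge0 ?sqr_ge0 ?ltW.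
rewrite ler_wpM2r ?sqr_ge0 //; apply: le_trans h1; rewrite ler_piMr ?(ltW A10) //.
by rewrite ler_pdivrMr // mul1r gerBl ltW.
Qed.

Lemma gyro2_le_offaxis2 lam M z : bounded_by M z ->
  gyro2 z <= 3 * M ^+ 2 * offaxis2 lam z.
Proof.
move=> bz; rewrite (gyro2_eq lam) lerBlDr ler_wpDr ?sqr_ge0 //.
rewrite ler_wpM2r //; first by apply: sumr_ge0 => i _; exact: sqr_ge0.
have h i : z.1 i 0 ^+ 2 <= M ^+ 2 by exact/sqr_le_of_norm/(bz (inl i)).
by rewrite sum3; have := h 0; have := h 1; have := h 2; lra.
Qed.

Lemma rhs_sqr_le M : exists2 C : R, 0 < C &
  forall (z : state R) j, bounded_by M z ->
    component (f z) j ^+ 2 <= C * residual z.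
Proof.
pose C := accel_const + k / I + 2 * `|M|.
have c0 := accel_const_ge0; have kI : 0 <= k / I by rewrite divr_ge0 // ltW.
exists (6 * C ^+ 2 + 1); first by rewrite ltr_wpDl // mulr_ge0 // sqr_ge0.
move=> z j bz.
pose d i := z.2 i 0 - z.1 i 0; pose n i := gyro z i 0.
pose U := `|d 0| + `|d 1| + `|d 2| + (`|n 0| + `|n 1| + `|n 2|).
have := normr_ge0 (d 0); have := normr_ge0 (d 1); have := normr_ge0 (d 2).
have := normr_ge0 (n 0); have := normr_ge0 (n 1); have := normr_ge0 (n 2).
move=> ? ? ? ? ? ?.
have dU i : `|d i| <= U by elim/ord3P: i; rewrite /U; lra.
have nU i : `|n i| <= U by elim/ord3P: i; rewrite /U; lra.
have U0 : 0 <= U by exact: le_trans (dU 0).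
have U2 : U ^+ 2 <= 6 * residual z.
  by rewrite /residual /slip2 /gyro2 !sum3; exact: sqr_sum6_le.
have MM := ler_norm M.
have xM i : `|z.1 i 0| <= `|M| by exact: le_trans (bz (inl i)) MM.
have fU : `|component (f z) j| <= C * U.
  case: j => i /=.
    rewrite [X in `|X|]rhs1E; apply: (@le_trans _ _ (accel_const * U)).
      apply: accel_le; [|exact: dU|exact: nU].
      by elim/ord3P: i => //=; exact: le_trans A12 A23.
    by rewrite ler_wpM2r // /C; have := normr_ge0 M; lra.
  rewrite [X in `|X|]rhs2E.
  have hc : `|crossmul z.1 z.2 i 0| <= 2 * `|M| * U.
    have -> : crossmul z.1 z.2 i 0 = crossmul z.1 (z.2 - z.1) i 0.
      by elim/ord3P: i; rewrite !crossmul_rec !mxE; ring.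
    have -> : 2 * `|M| * U = `|M| * U + `|M| * U by ring.
    have dU' i' : `|(z.2 - z.1) i' 0| <= U by have := dU i'; rewrite /d !mxE.
    by elim/ord3P: i; rewrite crossmul_rec; apply: norm_sub_le;
      apply: norm_mul_le; first [exact: xM|exact: dU'].
  have hk : `|- (k / I * (z.2 i 0 - z.1 i 0))| <= k / I * U.
    by rewrite normrN; exact: norm_scale_le kI (dU i).
  apply: le_trans (norm_sub_le hk hc) _.
  by rewrite -mulrDl ler_wpM2r // /C; lra.
apply: le_trans (sqr_le_of_norm fU) _; rewrite exprMn.
have := ler_wpM2l (sqr_ge0 C) U2.
have := residual_ge0 z.
by move: (C ^+ 2) (residual z) => c2 s; rewrite mulrDl; lra.
Qed.

(** The residual is quadratic at (w, w): both the slip and (lam - J) x vanish there,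
    and n = x cross (J - lam) x. *)
Lemma residual_near lam M (w : 'cV[R]_3) : eigenvector J lam w ->
  exists2 C : R, 0 < C & forall (z : state R) (e : R), bounded_by M z ->
    (forall j, `|component z j - component (w, w) j| <= e) ->
    residual z <= C * e ^+ 2.
Proof.
move=> eig; have w0 := eigenvector_coord eig.
pose c := \sum_(i < 3) (lam - [:: A1; A2; A3]`_i) ^+ 2.
have c0 : 0 <= c by apply: sumr_ge0 => i _; exact: sqr_ge0.
exists (12 + 3 * M ^+ 2 * c).
  by rewrite ltr_wpDr // mulr_ge0 // mulr_ge0 // sqr_ge0.
move=> z e bz hz; rewrite /residual mulrDl; apply: lerD.
  have h i : (z.2 i 0 - z.1 i 0) ^+ 2 <= (e + e) ^+ 2.
    apply: sqr_le_of_norm; have -> : z.2 i 0 - z.1 i 0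
      = (z.2 i 0 - w i 0) - (z.1 i 0 - w i 0) by ring.
    exact: norm_sub_le (hz (inr i)) (hz (inl i)).
  rewrite /slip2 sum3; have := h 0; have := h 1; have := h 2.
  by rewrite sqrrD -mulr_natr; lra.
apply: le_trans (gyro2_le_offaxis2 lam bz) _; rewrite -[leRHS]mulrA.
apply: ler_wpM2l; first by rewrite mulr_ge0 // sqr_ge0.
rewrite /offaxis2 /c mulr_suml; apply: ler_sum => i _.
have -> : (lam - [:: A1; A2; A3]`_i) * z.1 i 0
  = (lam - [:: A1; A2; A3]`_i) * (z.1 i 0 - w i 0) by rewrite mulrBr w0 subr0.
by rewrite exprMn ler_wpM2l ?sqr_ge0 // sqr_le_of_norm //; exact: (hz (inl i)).
Qed.

Lemma excess_le_near lam (w : 'cV[R]_3) : eigenvector J lam w ->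
  exists rho C : R, [/\ 0 < rho, 0 < C & forall z : state R,
    near_point rho (w, w) z -> `|excess lam z| <= C * residual z].
Proof.
move=> eig; have [rho [c [rho0 c0 hc]]] := offaxis2_le_gyro2 eig.
have [C C0 hC] := excess_le lam.
exists rho, (C * (1 + c^-1)); split => //.
  by rewrite mulr_gt0 // addr_gt0 ?invr_gt0.
move=> z hz; apply: le_trans (hC z) _; rewrite -mulrA ler_pM2l //.
have := hc z (fun i => hz (inl i)); rewrite -ler_pdivlMl // => h.
have g0 : 0 <= gyro2 z by apply: sumr_ge0 => i _; exact: sqr_ge0.
have s0 : 0 <= slip2 z by apply: sumr_ge0 => i _; exact: sqr_ge0.
have ci : 0 <= c^-1 by rewrite invr_ge0 ltW.
have := mulr_ge0 ci s0; rewrite /residual.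
by move: h; rewrite mulrDl mul1r mulrDr; lra.
Qed.

Lemma excess_ge_bounded M : exists2 c : R, 0 < c &
  forall z : state R, bounded_by M z -> c * residual z <= excess A3 z.
Proof.
pose m := 3 * M ^+ 2 + 1.
have m0 : 0 < m by rewrite ltr_wpDl // mulr_ge0 // sqr_ge0.
exists (Num.min (A1 * I) (A1 / A3 / m)).
  by rewrite lt_min mulr_gt0 //= !divr_gt0.
move=> z bz; apply: le_trans (excess_ge z); rewrite /residual mulrDr; apply: lerD.
  apply: ler_wpM2r; last by rewrite ge_min lexx.
  by apply: sumr_ge0 => i _; exact: sqr_ge0.
apply: (@le_trans _ _ (A1 / A3 / m * gyro2 z)).
  apply: ler_wpM2r; last by rewrite ge_min lexx orbT.
  by apply: sumr_ge0 => i _; exact: sqr_ge0.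
rewrite -mulrA ler_pM2l ?divr_gt0 // ler_pdivrMl //.
apply: le_trans (gyro2_le_offaxis2 A3 bz) _; apply: ler_wpM2r; last by rewrite lerDl.
by apply: sumr_ge0 => i _; exact: sqr_ge0.
Qed.

End RigidBody.

(** * Solutions of the differential equation *)

Section FirstOrder.
Context {R : realType}.

(** Common ground between two-sided derivatives (D = setT) and the difference
    quotients restricted to times after t0: a bound on the error of the tangent
    line, without division, which survives a change of g outside D. *)
Definition first_order_on (D : set R) (g : R -> R) (t a : R) : Prop :=
  forall e, 0 < e -> exists2 d : R, 0 < d & forall s, D s -> `|s - t| < d ->
    `|g s - g t - a * (s - t)| <= e * `|s - t|.

Lemma quotient_dist (g : R -> R) (s t a e : R) : s != t ->
  (`|a - (s - t)^-1 * (g s - g t)| <= e) =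
  (`|g s - g t - a * (s - t)| <= e * `|s - t|).
Proof.
move=> st; have st0 : s - t != 0 by rewrite subr_eq0.
rewrite -[RHS](ler_pM2r (x := `|s - t|^-1)) ?invr_gt0 ?normr_gt0 //.
rewrite -mulrA mulfV ?normr_eq0 // mulr1 -normfV -normrM -normrN.
by congr (`|_| <= _); field.
Qed.

Lemma first_order_onP (D : set R) (g : R -> R) (t a : R) :
  (fun s => (s - t)^-1 * (g s - g t)) @ within D t^' --> a
    <-> first_order_on D g t a.
Proof.
split=> [/cvgrPdist_le h e e0|h].
  have /nbhs_ballP[d /= d0 hd] := h e e0.
  exists d => // s Ds std; have [->|st] := eqVneq s t.
    by rewrite !subrr mulr0 subrr !normr0 mulr0.
  rewrite -quotient_dist //; apply: hd => //.
  by rewrite /ball /= distrC.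
apply/cvgrPdist_le => e e0; have [d d0 hd] := h e e0.
apply/nbhs_ballP; exists d => //= s ts st Ds.
by rewrite quotient_dist //; apply: hd => //; rewrite distrC.
Qed.

Lemma is_derive_first_orderP (g : R -> R) (t a : R) :
  is_derive t 1 g a <-> first_order_on setT g t a.
Proof.
split=> [[dg <-] e e0|h].
  have /cvgrPdist_le/(_ e e0)/nbhs_ballP[d /= d0 hd] := dg.
  exists d => // s _ std; have [->|st] := eqVneq s t.
    by rewrite !subrr mulr0 subrr !normr0 mulr0.
  have := hd (s - t); rewrite /ball /= sub0r normrN => /(_ std).
  by rewrite subr_eq0 /shift /= -quotient_dist // [_ *: 1]mulr1 subrK; exact.
have dg : (fun x => x^-1 *: ((g \o shift t) (x *: 1) - g t)) @ 0^' --> a.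
  apply/cvgrPdist_le => e e0; have [d d0 hd] := h e e0.
  apply/nbhs_ballP; exists d => //= x; rewrite /ball /= sub0r normrN => xd x0.
  have := hd (x + t) I; rewrite addrK => /(_ xd).
  rewrite -{2 3}[x](addrK t) -quotient_dist ?addrK; last by rewrite -subr_eq0 addrK.
  by rewrite [x *: 1]mulr1.
by split; [apply/cvg_ex; exists a|exact/cvg_lim].
Qed.

End FirstOrder.

Section Solutions.
Context {R : realType}.

Lemma ball_componentP (y x : state R) e : ball y e x <->
  0 < e /\ forall j, `|component y j - component x j| < e.
Proof.
split=> [[[e0 h1] [_ h2]]|[e0 h]].
  by split => // -[i|i]; [exact: h1|exact: h2].
by split; split=> // i j; rewrite !ord1; [exact: (h (inl i))|exact: (h (inr i))].
Qed.

Lemma is_solution_first_orderP (F : state R -> state R) t0 z0 z :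
  is_solution F t0 z0 z <-> z t0 = z0 /\ forall t, t0 <= t -> forall j,
    first_order_on [set s | t0 <= s] (fun s => component (z s) j) t
      (component (F (z t)) j).
Proof.
have componentZ (c : R) (x : state R) j : component (c *: x) j = c * component x j.
  by case: j => i /=; rewrite !mxE.
rewrite /is_solution; split=> -[-> h]; split=> // t t0t.
  move=> j; apply/first_order_onP/cvgrPdist_lt => e e0.
  have /cvg_ballP/(_ e e0) := h t t0t; apply: filterS => s /ball_componentP[_ /(_ j)].
  by rewrite componentZ componentB.
apply/cvg_ballP => e e0.
have hj j : \forall s \near within [set s | t0 <= s] t^',
   `|component (F (z t)) j - component ((s - t)^-1 *: (z s - z t)) j| < e.
  have /first_order_onP/cvgrPdist_lt/(_ e e0) := h t t0t j.
  by apply: filterS => s; rewrite componentZ componentB.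
have FF : Filter (within [set s | t0 <= s] t^') by exact: within_filter.
by apply: filterS (filter_forall FF hj) => s hs; apply/ball_componentP; split.
Qed.

(** Here the derivative at t0 is two-sided, so that the rules of calculus apply at
    every time.  A solution acquires this property once its values before t0
    are replaced by the tangent line at t0. *)
Definition solves (F : state R -> state R) (t0 : R) (z : R -> state R) : Prop :=
  forall t, t0 <= t -> forall j,
    is_derive t 1 (fun s => component (z s) j) (component (F (z t)) j).

Lemma solves_is_solution F t0 (z : R -> state R) :
  solves F t0 z -> is_solution F t0 (z t0) z.
Proof.
move=> hz; apply/is_solution_first_orderP; split=> // t t0t j e e0.
have /is_derive_first_orderP/(_ e e0)[d d0 hd] := hz t t0t j.
by exists d => // s _; exact: hd.
Qed.

Lemma is_solution_solves F t0 z0 (z : R -> state R) : is_solution F t0 z0 z ->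
  exists y : R -> state R, (forall t, t0 <= t -> y t = z t) /\ solves F t0 y.
Proof.
move=> /is_solution_first_orderP[zt0 hz].
pose y s := if t0 <= s then z s else z t0 + (s - t0) *: F (z t0).
have yE t : t0 <= t -> y t = z t by rewrite /y => ->.
exists y; split => // t t0t j.
apply/is_derive_first_orderP => e e0; have [d d0 hd] := hz t t0t j e e0.
rewrite (yE t) //; move: t0t; rewrite le_eqVlt => /predU1P[t0E|t0t].
  exists d => // s _ std; rewrite /y; case: (leP t0 s) => t0s; first exact: hd.
  rewrite t0E in t0s *.
  have -> : component (z t + (s - t) *: F (z t)) j
      = component (z t) j + component (F (z t)) j * (s - t).
    by case: (j) => i /=; rewrite !mxE mulrC.
  by rewrite [_ + _ * _]addrC addrK subrr normr0 mulr_ge0 // ltW.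
exists (Num.min d (t - t0)); first by rewrite lt_min d0 subr_gt0.
move=> s _; rewrite lt_min => /andP[std stt].
have t0s : t0 <= s by move: stt; rewrite ltr_norml => /andP[]; lra.
by rewrite yE //; exact: hd.
Qed.

(** Continuation principle: a trajectory that satisfies the strict bound whenever
    it satisfied the weak bound up to that time never violates the bound.  At the
    infimum of the times of violation the weak bound holds by continuity, hence
    the strict one, which then persists a little longer. *)
Lemma stay_within (J : finType) (h : J -> R -> R) (t0 rho : R) :
  (forall j t, t0 <= t -> {for t, continuous (h j)}) ->
  (forall j, `|h j t0| <= rho) ->
  (forall T, t0 <= T -> (forall t j, t0 <= t <= T -> `|h j t| <= rho) ->
     forall j, `|h j T| < rho) ->
  forall t j, t0 <= t -> `|h j t| <= rho.
Proof.
move=> hc h0 hT t1 j1 t01; rewrite leNgt; apply/negP => out1.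
pose out := [set t | t0 <= t /\ exists j, rho < `|h j t|].
have out_t1 : out t1 by split=> //; exists j1.
have lb : has_lbound out by exists t0 => t [].
have hinf : has_inf out by split => //; exists t1.
pose s := inf out.
have t0s : t0 <= s by apply: lb_le_inf; [exists t1|move=> t []].
have before t j : t0 <= t -> t < s -> `|h j t| <= rho.
  move=> t0t ts; rewrite leNgt; apply/negP => o.
  suff : s <= t by rewrite leNgt ts.
  by apply: ge_inf => //; split=> //; exists j.
have near_norm j (P : set R) : nbhs `|h j s| P ->
    exists2 d : R, 0 < d & forall t, `|t - s| < d -> P `|h j t|.
  move=> nP; have c : {for s, continuous (fun t => `|h j t|)}.
    by apply: continuous_comp; [exact: hc|exact: norm_continuous].
  have /nbhs_ballP[d /= d0 hd] := c _ nP.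
  by exists d => // t ts; apply: hd; rewrite /ball /= distrC.
have at_s j : `|h j s| <= rho.
  rewrite leNgt; apply/negP => o.
  have [t0E|t0s'] := eqVneq t0 s; first by move: o; rewrite -t0E ltNge h0.
  have {t0s'} t0s' : t0 < s by rewrite lt_def eq_sym t0s'.
  have [d d0 hd] := near_norm j _ (lt_nbhsr o).
  pose t := Num.max t0 (s - d / 2).
  have [t0t ts] : t0 <= t /\ t < s.
    by rewrite /t le_max lexx gt_max t0s'; split => //; lra.
  have : rho < `|h j t|.
    apply: hd; rewrite distrC ger0_norm ?subr_ge0 ?(ltW ts) //.
    have : s - d / 2 <= t by rewrite /t le_max lexx orbT.
    by lra.
  by rewrite ltNge before.
have near_s : \forall t \near s, forall j, `|h j t| < rho.
  apply: (@filter_forall R J (fun j t => `|h j t| < rho) (nbhs s)) => j.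
  have upto t i : t0 <= t <= s -> `|h i t| <= rho.
    move=> /andP[t0t]; rewrite le_eqVlt => /predU1P[->|]; first exact: at_s.
    exact: before.
  have [d d0 hd] := near_norm j _ (lt_nbhsl (hT s t0s upto j)).
  by apply/nbhs_ballP; exists d => //= t; rewrite /ball /= distrC => /hd.
have /nbhs_ballP[d /= d0 hd] := near_s.
have [t [t0t [j o]] ts] := inf_adherent d0 hinf.
have st : s <= t by apply: ge_inf => //; split=> //; exists j.
have : `|h j t| < rho.
  by apply: hd; rewrite /ball /= distrC ger0_norm ?subr_ge0 // -/s in ts *; lra.
by rewrite ltNge ltW.
Qed.

End Solutions.

(** * Truncation of the vector field *)

Section Truncation.
Context {R : realType}.
Local Notation idx := ('I_3 + 'I_3)%type.
Implicit Types (h : (idx -> R) -> R) (u v : idx -> R).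

Definition clamp (M x : R) : R := Num.max (- M) (Num.min M x).

Lemma clamp_id M x : `|x| <= M -> clamp M x = x.
Proof. by rewrite ler_norml => /andP[? ?]; rewrite /clamp min_r // max_r. Qed.

(** A single constant bounds h and its Lipschitz constant; such functions form a
    ring, which reduces the truncated field to its clamped coordinates. *)
Definition tame h : Prop :=
  exists2 B : R, 0 <= B & (forall u, `|h u| <= B) /\ lipschitz_with B h.

Lemma tame_ext h h' : h =1 h' -> tame h -> tame h'.
Proof. by move=> /funext ->. Qed.

Lemma tame_cst c : tame (fun=> c).
Proof.
exists `|c| => //; split=> // u v e he; rewrite subrr normr0 mulr_ge0 //.
exact: le_trans (he (inl 0)).
Qed.

Lemma tame_clamp M j : 0 <= M -> tame (fun u => clamp M (u j)).
Proof.
move=> M0; exists (M + 1); first by rewrite addr_ge0.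
have clampM x : `|clamp M x| <= M.
  rewrite ler_norml /clamp le_max lexx /= ge_max ge_min lexx andbT.
  by rewrite (le_trans _ M0) // oppr_le0.
split=> [u|u v e he]; first by apply: le_trans (clampM _) _; rewrite lerDl.
have e0 : 0 <= e by exact: le_trans (he j).
apply: (@le_trans _ _ e); last by rewrite ler_peMl // lerDr.
have := he j; rewrite ler_norml => /andP[h1 h2].
rewrite ler_norml /clamp; case: (leP M (u j)) => ?; case: (leP M (v j)) => ?;
  rewrite ?(max_r (ge0_cp M0).2); case: (leP (- M) (u j)) => ?;
  case: (leP (- M) (v j)) => ?; apply/andP; split; lra.
Qed.

Lemma tame_add h h' : tame h -> tame h' -> tame (fun u => h u + h' u).
Proof.
move=> [B B0 [hB hL]] [B' B'0 [hB' hL']]; exists (B + B'); first exact: addr_ge0.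
split=> [u|u v e he]; first exact: norm_add_le.
rewrite mulrDl opprD addrACA; apply: norm_add_le; [exact: hL|exact: hL'].
Qed.

Lemma tame_mul h h' : tame h -> tame h' -> tame (fun u => h u * h' u).
Proof.
move=> [B B0 [hB hL]] [B' B'0 [hB' hL']].
have BB := mulr_ge0 B0 B'0.
exists (B * B' + B * B'); first exact: addr_ge0.
split=> [u|u v e he].
  by apply: (@le_trans _ _ (B * B')); [exact: norm_mul_le|rewrite lerDl].
have -> : h u * h' u - h v * h' v = h u * (h' u - h' v) + (h u - h v) * h' v by ring.
have -> : (B * B' + B * B') * e = B * (B' * e) + B * e * B' by ring.
by apply: norm_add_le; apply: norm_mul_le => //; [exact: hL'|exact: hL].
Qed.

Lemma tame_opp h : tame h -> tame (fun u => - h u).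
Proof.
move=> th; apply: tame_ext (tame_mul (tame_cst (-1)) th) => u.
by rewrite mulN1r.
Qed.

End Truncation.

(** * Stability and instability *)

Section RigidBodyFlow.
Context {R : realType}.
Variables k I A1 A2 A3 : R.
Hypotheses (k0 : 0 < k) (I0 : 0 < I) (A10 : 0 < A1) (A12 : A1 <= A2)
  (A23 : A2 <= A3).

Local Notation J := (inertia A1 A2 A3).
Local Notation f := (rhs k I J).
Local Notation idx := ('I_3 + 'I_3)%type.
Local Notation res := (residual A1 A2 A3).

Definition truncated_rhs (M : R) (u : idx -> R) : idx -> R :=
  component (f (of_components (fun i => clamp M (u i)))).

Lemma truncated_rhs_tame M j : 0 <= M -> tame (truncated_rhs M ^~ j).
Proof.
move=> M0.
have c i := tame_clamp i M0.
have cs a (h : (idx -> R) -> R) : tame h -> tame (fun u => a * h u).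
  exact/tame_mul/tame_cst.
have cd i : tame (fun u => k * (clamp M (u (inr i)) - clamp M (u (inl i)))).
  exact: cs _ _ (tame_add (c _) (tame_opp (c _))).
have cg a i1 i2 : tame (fun u =>
    - (a * (clamp M (u (inl i1)) * clamp M (u (inl i2))))).
  exact: tame_opp (cs _ _ (tame_mul (c _) (c _))).
have cp (i : 'I_3) a i1 i2 : tame (fun u => ([:: A1; A2; A3]`_i)^-1 *
   (k * (clamp M (u (inr i)) - clamp M (u (inl i)))
   - a * (clamp M (u (inl i1)) * clamp M (u (inl i2))))).
  exact: cs _ _ (tame_add (cd _) (cg _ _ _)).
have cq i i1 i2 : tame (fun u =>
    - (k / I * (clamp M (u (inr i)) - clamp M (u (inl i))))
    - (clamp M (u (inl i1)) * clamp M (u (inr i2))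
       - clamp M (u (inl i2)) * clamp M (u (inr i1)))).
  apply: tame_add.
    exact: tame_opp (cs _ _ (tame_add (c _) (tame_opp (c _)))).
  exact: tame_opp (tame_add (tame_mul (c _) (c _)) (tame_opp (tame_mul (c _) (c _)))).
case: j => i.
  elim/ord3P: i; [apply: tame_ext (cp 0 (A3 - A2) 1 2) => u|
     apply: tame_ext (cp 1 (A1 - A3) 2 0) => u|
     apply: tame_ext (cp 2 (A2 - A1) 0 1) => u];
  by rewrite [RHS]rhs1E // gyroE !mxE; exact: mulrC.
elim/ord3P: i; [apply: tame_ext (cq 0 1 2) => u|apply: tame_ext (cq 1 2 0) => u|
   apply: tame_ext (cq 2 0 1) => u];
by rewrite [RHS]rhs2E // crossmul_rec !mxE.
Qed.

Lemma truncated_rhs_lipschitz M : 0 <= M -> exists2 L : R, 0 < L &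
  (forall u j, `|truncated_rhs M u j| <= L) /\
  (forall j, lipschitz_with L (truncated_rhs M ^~ j)).
Proof.
move=> M0; have ex j : exists B : R, [/\ 0 <= B,
    forall u, `|truncated_rhs M u j| <= B & lipschitz_with B (truncated_rhs M ^~ j)].
  by have [B B0 [? ?]] := truncated_rhs_tame j M0; exists B.
have {ex} [B hB] := choice ex.
have B0 j : 0 <= B j by have [] := hB j.
have BL j : B j <= \sum_i B i + 1.
  by rewrite (bigD1 j) //= -addrA lerDl addr_ge0 // sumr_ge0.
exists (\sum_i B i + 1); first by rewrite ltr_wpDl // sumr_ge0.
split=> [u j|j u v e he]; have [_ h1 h2] := hB j.
  exact: le_trans (h1 u) (BL j).
apply: le_trans (h2 _ _ _ he) _; rewrite ler_wpM2r //.
exact: le_trans (he j).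
Qed.

Lemma truncated_rhsE M z : bounded_by M z ->
  truncated_rhs M (component z) = component (f z).
Proof.
move=> bz; rewrite /truncated_rhs; congr (component (f _)).
by apply: component_inj => j; rewrite of_componentsK clamp_id.
Qed.

(** The hypothesis on z asks for the equation only while z is near (w, w).  Thus the
    lemma applies both to solutions of the equation and to solutions of the
    truncated equation, which are not yet known to be solutions of the former. *)
Lemma local_attraction (w : 'cV[R]_3) : eigenvector J A3 w ->
  exists rho K c : R, [/\ 0 < rho, 0 < K, 0 < c &
  forall (z : R -> state R) (t0 eta : R), eta * (1 + K / c) < rho ->
    near_point eta (w, w) (z t0) ->
    (forall t j, t0 <= t -> {for t, continuous (fun s => component (z s) j)}) ->
    (forall t j, t0 <= t -> near_point rho (w, w) (z t) ->
       is_derive t 1 (fun s => component (z s) j) (component (f (z t)) j)) ->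
    forall t, t0 <= t -> [/\ near_point rho (w, w) (z t),
      near_point (eta * (1 + K / c)) (w, w) (z t) &
      forall j, `|component (f (z t)) j| <= eta * K * expR (- c * (t - t0))]].
Proof.
move=> eig.
have A30 : 0 < A3 by exact: lt_le_trans (lt_le_trans A10 A12) A23.
have [rho [Ce [rho0 Ce0 hCe]]] := excess_le_near I0 eig.
pose M := norm_bound rho (w, w).
have inM z : near_point rho (w, w) z -> bounded_by M z by exact: near_point_bounded.
have [c1 c10 hc1] := excess_ge_bounded I0 A10 A12 A23 M.
have [Cf Cf0 hCf] := rhs_sqr_le k0 I0 A10 A12 A23 M.
have [Ci Ci0 hCi] := residual_near M eig.
have [eps [kap [eps0 epsc kap0 hV]]] := lyap_dissipation k0 I0 A10 A12 A23 M A30 c10.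
pose V := lyap I A1 A2 A3 A3 eps.
have res0 z : 0 <= res z by exact: residual_ge0.
have mix z : `|eps * mixed A1 A2 A3 z| <= c1 * res z / 2.
  rewrite -mulrA; apply: norm_mul_le; last exact: mixed_le.
  by rewrite ger0_norm // ltW.
pose Cv := Ce + c1 / 2; have Cv0 : 0 < Cv by rewrite addr_gt0 // divr_gt0.
have Vle z : near_point rho (w, w) z -> V z <= Cv * res z.
  move=> hz; have := hCe z hz; have := mix z; rewrite !ler_norml.
  by move=> /andP[_ ?] /andP[_ ?]; rewrite /V /lyap /Cv mulrDl; lra.
have Vge z : near_point rho (w, w) z -> c1 / 2 * res z <= V z.
  move=> hz; have := hc1 z (inM z hz); have := mix z; rewrite !ler_norml.
  by move=> /andP[? _]; rewrite /V /lyap; lra.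
pose c := kap / (2 * Cv); have c0 : 0 < c by rewrite divr_gt0 // mulr_gt0.
pose Q := Cf * (2 / c1) * (Cv * Ci).
have Q0 : 0 < Q by rewrite !mulr_gt0 ?invr_gt0.
pose K := 1 + Q; have K0 : 0 < K by rewrite addr_gt0.
exists rho, K, c; split => // z t0 eta eta_rho z0 zc zd.
have eta0 : 0 <= eta by exact: le_trans (z0 (inl 0)).
have est T : t0 <= T -> (forall t, t0 <= t <= T -> near_point rho (w, w) (z t)) ->
    [/\ near_point rho (w, w) (z T), near_point (eta * (1 + K / c)) (w, w) (z T) &
     forall j, `|component (f (z T)) j| <= eta * K * expR (- c * (T - t0))].
  move=> t0T hnear.
  have nT : near_point rho (w, w) (z T) by apply: hnear; rewrite t0T lexx.
  have n0 : near_point rho (w, w) (z t0) by apply: hnear; rewrite t0T lexx.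
  have speed t j : t0 <= t <= T ->
      `|component (f (z t)) j| <= eta * K * expR (- c * (t - t0)).
    move=> /andP[t0t tT].
    have nt : near_point rho (w, w) (z t) by apply: hnear; rewrite t0t.
    (* lyap decays at the rate 2 c: its derivative is at most - kap res, and
       res >= V / Cv, where 2 c = kap / Cv. *)
    pose G s := V (z s) * expR (2 * c * (s - t0)).
    have decay : G t <= G t0.
      apply: derive_le0_nonincreasing => // s /andP[t0s st].
      have ns : near_point rho (w, w) (z s).
        by apply: hnear; rewrite t0s (le_trans st).
      have [dV hdV dVle] := hV z s (fun j => zd s j t0s ns).
      eexists; first exact: is_derive_mul hdV (is_derive_expR_affine (2 * c) t0 s).
      have := dVle (inM _ ns); have := Vle _ ns; rewrite -/V.
      set v := V (z s); set r := res (z s); set e := expR _ => v_le dV_le.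
      have -> : v * (2 * c * e) + e * dV = e * (2 * c * v + dV) by ring.
      apply: mulr_ge0_le0; first exact: expR_ge0.
      have : 2 * c * v <= kap * r.
        have -> : kap * r = 2 * c * (Cv * r) by rewrite /c; field; rewrite gt_eqF.
        by rewrite ler_pM2l // mulr_gt0.
      by lra.
    pose e := expR (- c * (t - t0)).
    have e2 : expR (2 * c * (t - t0)) = (e ^+ 2)^-1.
      by rewrite /e expr2 -expRD -expRN; congr expR; ring.
    have Vt : V (z t) <= Cv * (Ci * eta ^+ 2) * e ^+ 2.
      move: decay; rewrite /G subrr mulr0 expR0 mulr1 e2 ler_pdivrMr; last first.
        by rewrite exprn_gt0 // expR_gt0.
      move=> /le_trans; apply; rewrite ler_wpM2r ?sqr_ge0 //.
      apply: le_trans (Vle _ n0) _; rewrite ler_pM2l //.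
      exact: hCi (inM _ n0) z0.
    have f2 : component (f (z t)) j ^+ 2 <= (eta * K * e) ^+ 2.
      apply: le_trans (hCf _ j (inM _ nt)) _.
      apply: (@le_trans _ _ (Q * (eta ^+ 2 * e ^+ 2))).
        have -> : Q * (eta ^+ 2 * e ^+ 2)
          = Cf * (2 / c1 * (Cv * (Ci * eta ^+ 2) * e ^+ 2)) by rewrite /Q; ring.
        rewrite ler_pM2l //; apply: le_trans (ler_wpM2l _ Vt); last first.
          by rewrite divr_ge0 // ltW.
        have := Vge _ nt; have -> : c1 / 2 = (2 / c1)^-1 by rewrite invf_div.
        by rewrite ler_pdivrMl // divr_gt0.
      have -> : (eta * K * e) ^+ 2 = K ^+ 2 * (eta ^+ 2 * e ^+ 2) by ring.
      apply: ler_wpM2r; first by rewrite mulr_ge0 ?sqr_ge0.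
      have -> : K ^+ 2 = 1 + 2 * Q + Q ^+ 2 by rewrite /K; ring.
      by have := sqr_ge0 Q; lra.
    have ee0 : 0 <= eta * K * e by rewrite mulr_ge0 ?expR_ge0 // mulr_ge0 // ltW.
    by rewrite -ler_sqr ?nnegrE // real_normK ?num_real.
  split=> //; last by move=> j; apply: speed; rewrite t0T lexx.
  move=> j; rewrite -(subrK (component (z t0) j) (component (z T) j)) -addrA.
  rewrite mulrDr mulr1 addrC; apply: norm_add_le; first exact: z0.
  (* A primitive of the bound on the speed, of total variation at most
     eta K / c. *)
  pose g s := - (eta * (K / c)) * expR (- c * (s - t0)).
  apply: (@le_trans _ _ (g T - g t0)).
    apply: (increment_le_dominated t0T (f := fun s => component (z s) j) (g := g)
      (df := fun s => component (f (z s)) j)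
      (dg := fun s => - (eta * (K / c)) * (- c * expR (- c * (s - t0))))).
    - by move=> s sT; apply: zd; [case/andP: sT|exact: hnear].
    - by move=> s _; apply: is_derive_scale; exact: is_derive_expR_affine.
    - move=> s sT; apply: le_trans (speed s j sT) _; rewrite le_eqVlt.
      by apply/orP; left; apply/eqP; field; rewrite gt_eqF.
  rewrite /g subrr mulr0 expR0 mulr1 opprK mulNr gerDr oppr_le0.
  by rewrite mulr_ge0 ?expR_ge0 // mulr_ge0 // divr_ge0 // ltW.
have etaK : eta <= eta * (1 + K / c).
  by rewrite ler_peMr // lerDl divr_ge0 // ltW.
have inside t j : t0 <= t -> `|component (z t) j - component (w, w) j| <= rho.
  apply: (@stay_within R _ (fun j t => component (z t) j - component (w, w) j) t0).
  - move=> {}j {}t t0t; apply: continuousB; [exact: zc|exact: cst_continuous].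
  - by move=> i; apply: le_trans (z0 i) _; exact: le_trans etaK (ltW eta_rho).
  - move=> T t0T hT i; have [|_ h _] := est T t0T; last exact: le_lt_trans (h i) _.
    by move=> s sT i'; exact: hT.
move=> t t0t; apply: est => // s /andP[t0s _] j; exact: inside.
Qed.

(** Uniqueness holds among all solutions of the equation, not only among those that
    stay near (w, w): by local_attraction any solution starting there is trapped,
    hence solves the truncated equation. *)
Lemma local_flow (w : 'cV[R]_3) : eigenvector J A3 w ->
  exists rho K c : R, [/\ 0 < rho, 0 < K, 0 < c &
  forall t0 z0 eta, eta * (1 + K / c) < rho -> near_point eta (w, w) z0 ->
    exists z : R -> state R, [/\ is_unique_solution f t0 z0 z, z t0 = z0,
      solves f t0 z &
      forall t, t0 <= t -> near_point (eta * (1 + K / c)) (w, w) (z t) /\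
        forall j, `|component (f (z t)) j| <= eta * K * expR (- c * (t - t0))]].
Proof.
move=> eig; have [rho [K [c [rho0 K0 c0 attr]]]] := local_attraction eig.
exists rho, K, c; split => // t0 z0 eta eta_rho near0.
pose M := norm_bound rho (w, w).
have M0 : 0 <= M by rewrite addr_ge0 ?sumr_ge0 // ltW.
have [L L0 [gB gL]] := truncated_rhs_lipschitz M0.
have [u [u0 hu]] := picard_exists t0 (component z0) L0 gB gL.
pose z t := of_components (u^~ t).
have zE t : component (z t) = u^~ t by rewrite /z of_componentsK.
have zt0 : z t0 = z0 by apply: component_inj => j; rewrite zE.
have truncE p : near_point rho (w, w) p ->
    truncated_rhs M (component p) = component (f p).
  by move=> hp; apply: truncated_rhsE; exact: near_point_bounded.
have zfun j : (fun s => component (z s) j) = u j by apply/funext => s; rewrite zE.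
have hz := attr z t0 eta eta_rho; rewrite zt0 in hz; have {}hz := hz near0.
have {}hz : forall t, t0 <= t -> [/\ near_point rho (w, w) (z t),
      near_point (eta * (1 + K / c)) (w, w) (z t) &
      forall j, `|component (f (z t)) j| <= eta * K * expR (- c * (t - t0))].
  apply: hz => [t j t0t|t j t0t nz]; rewrite zfun.
    exact: is_derive_continuous (hu t j t0t).
  by rewrite -truncE // zE; exact: hu.
have zsolves : solves f t0 z.
  move=> t t0t j; have [nz _ _] := hz t t0t.
  by rewrite zfun -truncE // zE; exact: hu.
exists z; split => //; last by move=> t /hz[].
split; first by rewrite -zt0; exact: solves_is_solution.
move=> y0 /[dup] y0sol /is_solution_solves[y [yE ysolves]] t t0t.
have yt0 : y t0 = z0 by rewrite yE //; case: y0sol.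
have hy t' : t0 <= t' -> near_point rho (w, w) (y t').
  move=> t0t'; have [|t2 j t02|t2 j t02 _|//] := attr y t0 eta eta_rho _ _ _ t' t0t'.
  - by rewrite yt0.
  - exact: is_derive_continuous (ysolves t2 t02 j).
  - exact: ysolves.
rewrite -yE //; apply: component_inj => j.
apply: (@picard_unique R _ (truncated_rhs M) L (rho + rho) t0
  (fun j s => component (y s) j) (fun j s => component (z s) j)) => //.
- by move=> i; rewrite yt0 zt0.
- move=> s i t0s; have := ysolves s t0s i.
  by rewrite -(truncE _ (hy s t0s)).
- move=> s i t0s; have := zsolves s t0s i; have [nz _ _] := hz s t0s.
  by rewrite -(truncE _ nz).
- move=> s i t0s; have [nz _ _] := hz s t0s.
  have -> : component (y s) i - component (z s) i
    = (component (y s) i - component (w, w) i)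
      - (component (z s) i - component (w, w) i) by ring.
  exact: norm_sub_le (hy s t0s i) (nz i).
Qed.

Lemma top_axis_lyapunov_stable (w : 'cV[R]_3) t0 : eigenvector J A3 w ->
  lyapunov_stable f t0 (w, w).
Proof.
move=> /local_flow[rho [K [c [rho0 K0 c0 flow]]]] e e0.
pose k1 := 1 + K / c; have k10 : 0 < k1 by rewrite addr_gt0 // divr_gt0.
pose d := Num.min (rho / (2 * k1)) (e / (6 * k1)).
have d0 : 0 < d by rewrite lt_min !divr_gt0 // mulr_gt0.
have dk1 : d * k1 < rho.
  apply: (@le_lt_trans _ _ (rho / 2)); last by lra.
  have -> : rho / 2 = rho / (2 * k1) * k1 by field; rewrite gt_eqF.
  by rewrite ler_pM2r // ge_min lexx.
have dk2 : d * k1 <= e / 6.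
  have -> : e / 6 = e / (6 * k1) * k1 by field; rewrite gt_eqF.
  by rewrite ler_pM2r // ge_min lexx orbT.
exists d => // z0 hz0.
have near0 : near_point d (w, w) z0.
  by move=> j; rewrite -componentB; apply: le_trans (component_le_enorm _ _) hz0.
have [z [zu _ _ hz]] := flow t0 z0 d dk1 near0.
exists z => // t t0t; have [nz _] := hz t t0t.
apply: (@le_lt_trans _ _ (3 * (d * k1))); last by lra.
by apply: enorm_le => j; rewrite componentB; exact: nz.
Qed.

Lemma le0_of_exp_decay (x C c : R) : 0 <= C -> 0 < c ->
  (forall t, 0 <= t -> x <= C * expR (- c * t)) -> x <= 0.
Proof.
move=> C0 c0 h; apply: (@le_of_geometric_slack _ _ _ C) => n; rewrite add0r.
apply: le_trans (h (n%:R / c) _) _; first by rewrite divr_ge0 // ltW.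
rewrite ler_wpM2l // mulNr mulrCA mulfV ?gt_eqF // mulr1 expRN.
rewrite lef_pV2 ?posrE ?expR_gt0 ?exprn_gt0 // -[n%:R]mulr1 expRM_natl.
by rewrite lerXn2r ?nnegrE ?expR_ge0 //; have := @expR_ge1Dx R 1; lra.
Qed.

(** Each coordinate converges at the rate at which its derivative decays.  The limit
    is a zero of the field because the field is Lipschitz near (w, w) and tends
    to 0 along the trajectory. *)
Lemma top_axis_exponentially_stable (w : 'cV[R]_3) t0 : eigenvector J A3 w ->
  exponentially_stable f t0 (w, w).
Proof.
move=> eig; split; first exact: top_axis_lyapunov_stable.
have [rho [K [c [rho0 K0 c0 flow]]]] := local_flow eig.
pose k1 := 1 + K / c; have k10 : 0 < k1 by rewrite addr_gt0 // divr_gt0.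
pose d := rho / (2 * k1); have d0 : 0 < d by rewrite divr_gt0 // mulr_gt0.
have dk1 : d * k1 < rho.
  have -> : d * k1 = rho / 2 by rewrite /d; field; rewrite gt_eqF.
  by lra.
exists d => // z0 hz0.
have near0 : near_point d (w, w) z0.
  move=> j; rewrite -componentB.
  exact: le_trans (component_le_enorm _ _) (ltW hz0).
have [z [zu zt0 zsol hz]] := flow 0 z0 d dk1 near0.
exists z => //.
pose r := d * K / c; have r0 : 0 < r by rewrite divr_gt0 // mulr_gt0.
have speed t j : 0 <= t -> `|component (f (z t)) j| <= r * c * expR (- c * t).
  move=> t0'; have [_ /(_ j)] := hz t t0'; rewrite subr0.
  by have -> : r * c = d * K by rewrite /r; field; rewrite gt_eqF.
have limit j : exists l, forall t, 0 <= t ->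
    `|component (z t) j - l| <= r * expR (- c * t).
  pose E t := r * expR (- c * (t - 0)).
  have dE (t : R) : is_derive t 1 E (r * (- c * expR (- c * (t - 0)))).
    by apply: is_derive_scale; exact: is_derive_expR_affine.
  have mono (s t : R) : 0 <= s -> s <= t ->
      component (z s) j - E s <= component (z t) j - E t /\
      component (z t) j + E t <= component (z s) j + E s.
    move=> s0 st; split.
      rewrite -lerN2.
      apply: (@derive_le0_nonincreasing _
        (fun v => - (component (z v) j - E v))) => //.
      move=> v /andP[sv _]; have v0 : 0 <= v by exact: le_trans sv.
      eexists; first exact: is_derive_opp (is_derive_sub (zsol v v0 j) (dE v)).
      have := speed v j v0; rewrite ler_norml => /andP[h _]; rewrite subr0; lra.
    apply: (@derive_le0_nonincreasing _ (fun v => component (z v) j + E v)) => //.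
    move=> v /andP[sv _]; have v0 : 0 <= v by exact: le_trans sv.
    eexists; first exact: is_derive_add (zsol v v0 j) (dE v).
    have := speed v j v0; rewrite ler_norml => /andP[_ h]; rewrite subr0; lra.
  have E0 (t : R) : 0 <= E t by rewrite mulr_ge0 ?expR_ge0 // ltW.
  have [|l hl] := @sup_between R R 0 (fun t => component (z `|t|) j - E `|t|)
      (fun t => component (z `|t|) j + E `|t|).
    move=> s t; pose m := Num.max `|s| `|t|.
    have [h1 _] := mono `|s| m (normr_ge0 s) ltac:(by rewrite le_max lexx).
    have [_ h2] := mono `|t| m (normr_ge0 t) ltac:(by rewrite le_max lexx orbT).
    by have := E0 m; lra.
  exists l => t t0'; have := hl t; rewrite ger0_norm // /E subr0.
  by move=> /andP[? ?]; rewrite ler_norml; apply/andP; split; lra.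
have [l hl] := choice limit.
pose zoo := of_components l.
have zooE : component zoo = l by rewrite /zoo of_componentsK.
have near_oo : near_point rho (w, w) zoo.
  move=> j; rewrite zooE.
  have := hl j 0 (lexx 0); rewrite mulr0 expR0 mulr1 zt0 => h.
  have -> : l j - component (w, w) j
    = (component z0 j - component (w, w) j) - (component z0 j - l j) by ring.
  apply: le_trans (norm_sub_le (near0 j) h) _.
  have -> : d + r = d * k1 by rewrite /r /k1; ring.
  exact: ltW.
exists zoo, (3 * r), c; split => //.
- pose M := norm_bound rho (w, w).
  have M0 : 0 <= M by rewrite addr_ge0 ?sumr_ge0 // ltW.
  have [L L0 [_ gL]] := truncated_rhs_lipschitz M0.
  apply: component_inj => j.
  have -> : component (0 : state R) j = 0 by case: (j) => i /=; rewrite mxE.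
  apply/eqP; rewrite -normr_le0.
  have rL0 : 0 <= r * c + L * r by apply: addr_ge0; apply: mulr_ge0; exact: ltW.
  apply: (le0_of_exp_decay rL0 c0) => t t0'; rewrite mulrDl.
  have nz : near_point rho (w, w) (z t).
    by move=> i; have [h _] := hz t t0'; apply: le_trans (h i) (ltW dk1).
  have e1 := truncated_rhsE (near_point_bounded near_oo).
  have e2 := truncated_rhsE (near_point_bounded nz).
  have := gL j (component zoo) (component (z t)) (r * expR (- c * t)).
  rewrite e1 e2 => h.
  rewrite -[component (f zoo) j](subrK (component (f (z t)) j)) addrC.
  apply: norm_add_le; first exact: speed.
  by rewrite -mulrA; apply: h => i; rewrite zooE distrC; exact: hl.
- by rewrite mulr_gt0.
- move=> t t0'; rewrite -mulrA; apply: enorm_le => j.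
  by rewrite componentB zooE; exact: hl.
Qed.

Lemma lower_axis_unstable lam (w : 'cV[R]_3) t0 :
  eigenvector J lam w -> 0 < lam -> lam < A3 -> unstable f t0 (w, w).
Proof.
move=> eig lam0 lamA stable.
have [rho [C [rho0 C0 hC]]] := excess_le_near I0 eig.
pose M := norm_bound rho (w, w).
have [eps [kap [eps0 _ kap0 hV]]] := lyap_dissipation k0 I0 A10 A12 A23 M lam0 ltr01.
have [d d0 hd] := stable rho rho0.
have w3 : w 2 0 = 0.
  have /eqP := eigenvector_coord eig 2; rewrite mulf_eq0 /= subr_eq0 lt_eqF //=.
  by move/eqP.
(* The third coordinate of w is 0, so a displacement by h along the third axis
   has excess (lam - A3) (A3 + I) h^2 < 0. *)
pose h := d / 3; have h0 : 0 < h by rewrite divr_gt0.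
pose v := w + \col_i (if i == 2 then h else 0).
have [|z [zsol _] hz] := hd (v, v).
  have -> : d = 3 * h by rewrite /h; field.
  apply: enorm_le => j; rewrite componentB.
  have hv i : `|v i 0 - w i 0| <= h.
    rewrite !mxE addrAC subrr add0r; case: ifP => _; last by rewrite normr0 ltW.
    by rewrite ger0_norm // ltW.
  by case: j => i; exact: hv.
have [y [yE ysol]] := is_solution_solves zsol.
have yt0 : y t0 = (v, v) by rewrite yE //; case: zsol.
have ny t : t0 <= t -> near_point rho (w, w) (y t).
  move=> t0t j; rewrite -componentB yE //.
  exact: le_trans (component_le_enorm _ _) (ltW (hz t t0t)).
pose W := excess I A1 A2 A3 lam.
have W0 : W (y t0) < 0.
  have w1 := eigenvector_coord eig 0; have w2 := eigenvector_coord eig 1.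
  have e (a x b : R) : a * x = 0 -> a * (b * x ^+ 2 + I * x ^+ 2) = 0.
    move=> ax; transitivity (a * x * ((b + I) * x)); first by ring.
    by rewrite ax mul0r.
  rewrite yt0 /W /excess sum3 /= !mxE /= !addr0 w3 add0r !subrr.
  rewrite expr0n /= !mulr0 !addr0 (e _ _ _ w1) (e _ _ _ w2) !add0r.
  rewrite nmulr_rlt0 ?subr_lt0 // -mulrDl mulr_gt0 ?exprn_gt0 // addr_gt0 //.
  exact: lt_le_trans (lt_le_trans A10 A12) A23.
have Wle t : t0 <= t -> W (y t) <= W (y t0).
  move=> t0t; apply: (@derive_le0_nonincreasing _ (fun s => W (y s))) => //.
  move=> s /andP[t0s _]; eexists.
    exact: (is_derive_excess I0 A10 A12 A23 (ysol s t0s) lam).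
  rewrite oppr_le0 mulr_ge0 //; first by rewrite mulr_ge0 ?mulr_ge0 ?addr_ge0 // ltW.
  by apply: sumr_ge0 => i _; exact: sqr_ge0.
pose V := lyap I A1 A2 A3 lam eps.
pose q := kap * (- W (y t0) / C).
have q0 : 0 < q by rewrite mulr_gt0 // divr_gt0 // oppr_gt0.
have Vle t : t0 <= t -> V (y t) + q * (t - t0) <= V (y t0).
  move=> t0t; have -> : V (y t0) = V (y t0) + q * (t0 - t0).
    by rewrite subrr mulr0 addr0.
  apply: (@derive_le0_nonincreasing _ (fun s => V (y s) + q * (s - t0))) => //.
  move=> s /andP[t0s _]; have ns := ny s t0s.
  have [dV hdV dVle] := hV y s (ysol s t0s).
  eexists.
    exact: is_derive_add hdV (is_derive_scale q
      (is_derive_sub (is_derive_id s 1) (is_derive_const t0 s))).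
  rewrite subr0 mulr1; have {dVle} := dVle (near_point_bounded ns).
  suff : q <= kap * res (y s) by lra.
  rewrite ler_pM2l // ler_pdivrMr // mulrC.
  have := Wle s t0s; have := hC _ ns.
  by rewrite ler_norml -/(W (y s)) => /andP[? _]; lra.
have [Ci Ci0 hCi] := residual_near M eig.
pose B := (C + eps) * (Ci * rho ^+ 2).
have VB t : t0 <= t -> `|V (y t)| <= B.
  move=> t0t; have ns := ny t t0t.
  have res0 : 0 <= res (y t) by exact: residual_ge0.
  apply: (@le_trans _ _ ((C + eps) * res (y t))); last first.
    rewrite ler_pM2l ?addr_gt0 //; exact: hCi (near_point_bounded ns) ns.
  rewrite mulrDl; apply: norm_add_le; first exact: hC.
  apply: norm_scale_le; first exact: ltW.
  by apply: le_trans (mixed_le _ _ _ _) _; lra.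
have B0 : 0 <= B by exact: le_trans (VB t0 (lexx _)).
pose T := t0 + (2 * B + 1) / q.
have t0T : t0 <= T by rewrite lerDl divr_ge0 ?(ltW q0) // addr_ge0 // mulr_ge0.
have := Vle T t0T; have := VB T t0T; have := VB t0 (lexx _).
have -> : q * (T - t0) = 2 * B + 1 by rewrite /T; field; rewrite gt_eqF.
by rewrite !ler_norml => /andP[? ?] /andP[? ?]; lra.
Qed.

End RigidBodyFlow.

Theorem theorem11 (R : realType) (k I A1 A2 A3 : R)
    (hk : 0 < k) (hI : 0 < I) (hA1 : 0 < A1) (hA12 : A1 <= A2) (hA23 : A2 <= A3)
    (t0 : R) (ht0 : 0 <= t0) (Oms Om1s : 'cV[R]_3) (lam : R)
    (heq : equilibria (rhs k I (inertia A1 A2 A3)) (Oms, Om1s))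
    (hOm : Oms = Om1s)
    (hlam : lam \in [:: A1; A2; A3])
    (heig : eigenvector (inertia A1 A2 A3) lam Oms) :
  (lam = A3 ->
     exponentially_stable (rhs k I (inertia A1 A2 A3)) t0 (Oms, Om1s)) /\
  (lam \in [:: A1; A2] -> A2 < A3 ->
     unstable (rhs k I (inertia A1 A2 A3)) t0 (Oms, Om1s)).
Proof.
subst Om1s; split=> [lamE|lam12 A2A3].
  by rewrite lamE in heig; exact: top_axis_exponentially_stable.
have [lam0 lamA2] : 0 < lam /\ lam <= A2.
  move: lam12; rewrite !inE => /orP[/eqP ->|/eqP ->]; split => //.
  exact: lt_le_trans hA12.
exact: lower_axis_unstable (le_lt_trans lamA2 A2A3).
Qed.
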